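(* For every $\mathbf b\in\mathrm{Comp}_{p,n}$ and every $h\in\mathcal H_{d,\mathbf b}$, $$\mathrm{Tr}\big(v_{\mathbf b}\,\Theta_{\mathbf b}(h)\,T_{\mathbf b}\big)=\mathrm{Tr}_{\mathbf b}(h)\,\mathrm{Tr}(v_{\mathbf b}T_{\mathbf b}).$$
   Context: Fix integers $p>1$, $d\ge1$, $n\ge3$, $r=pd$; $R$ a commutative ring with a primitive $p$th root of unity $\varepsilon$; $q,Q_1,\dots,Q_d\in R$ invertible, $\mathbf Q=(Q_1,\dots,Q_d)$. For a tuple $\mathbf Q'$ of $s$ units, $\mathcal H_{s,m}(\mathbf Q')$ is the Ariki–Koike algebra with parameters $q,\mathbf Q'$ (generators $T_0,\dots,T_{m-1}$, relations $\prod_i(T_0-Q'_i)=0$, $(T_i-q)(T_i+1)=0$, $T_0T_1T_0T_1=T_1T_0T_1T_0$, type A braid relations), with Jucys–Murphy elements $L_1=T_0$, $L_{k+1}=q^{-1}T_kL_kT_k$, elements $T_w$ ($w\in\mathfrak S_m$, via reduced expressions) and $R$-basis $\{L_1^{a_1}\cdots L_m^{a_m}T_w:0\le a_j<s,w\in\mathfrak S_m\}$. $\mathcal H_{r,n}=\mathcal H_{r,n}(\varepsilon Q_1,\dots,\varepsilon Q_d,\dots,\varepsilon^pQ_1,\dots,\varepsilon^pQ_d)$. $\mathrm{Tr}:\mathcal H_{r,n}\to R$ is the $R$-linear map with $\mathrm{Tr}(L_1^{a_1}\cdots L_n^{a_n}T_w)=1$ if all $a_j=0$ and $w=1$, and $0$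 otherwise ($0\le a_j<r$). In $\mathcal H_{r,n}$: $L^{(s)}_k=\prod_{i=1}^d(L_k-\varepsilon^sQ_i)$; $L^{(i,j)}_{l,m}=\prod_{k=l}^m\prod_{s\in I_{ij}}L^{(s)}_k$ with $I_{ij}=\{i,\dots,j\}$ ($i\le j$) or $\{1,\dots,j\}\cup\{i,\dots,p\}$ ($i>j$), superscripts mod $p$, $L^{(s)}_{l,m}=L^{(s,s)}_{l,m}$, empty products $1$; $w_{a,b}=(s_{a+b-1}\cdots s_1)^b$, $w^{\langle k\rangle}_{a,b}=(s_{a+b+k-1}\cdots s_{k+1})^b$, $T_{a,b}=T_{w_{a,b}}$. $\mathrm{Comp}_{p,n}$: compositions $\mathbf b=(b_1,\dots,b_p)$ of $n$ into $p$ nonnegative parts; $\mathbf b_i^j=b_i+\dots+b_j$ ($i\le j$), $0$ otherwise. $v_{\mathbf b}=L^{(1,p-1)}_{1,b_p}T_{b_p,\mathbf b_1^{p-1}}\cdots L^{(1,1)}_{1,b_2}T_{b_2,\mathbf b_1^1}\cdot L^{(2)}_{1,\mathbf b_1^1}\cdots L^{(p)}_{1,\mathbf b_1^{p-1}}$; $w_{\mathbf b}=w^{\langle\mathbf b_1^{p-2}\rangle}_{b_{p-1},\mathbf b_p^p}\cdots w^{\langle\mathbf b_1^1\rangle}_{b_2,\mathbf b_3^p}w_{b_1,\mathbf b_2^p}$, $T_{\mathbf b}=T_{w_{\mathbf b}}$. $\mathcal H_{d,\mathbf b}=\mathcal H_{d,b_1}(\varepsilon\mathbf Q)\otimes\cdots\otimes\mathcal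 H_{d,b_p}(\varepsilon^p\mathbf Q)$, with $\mathrm{Tr}_{\mathbf b}:\mathcal H_{d,\mathbf b}\to R$ the $R$-linear map sending a basis element $\bigotimes_t(L_1^{a_{t,1}}\cdots L_{b_t}^{a_{t,b_t}}T_{x_t})$ ($0\le a_{t,j}<d$, $x_t\in\mathfrak S_{b_t}$) to $1$ if all $a_{t,j}=0$ and all $x_t=1$, and to $0$ otherwise. $\Theta_{\mathbf b}:\mathcal H_{d,\mathbf b}\to\mathcal H_{r,n}$ is the $R$-linear map sending this basis element to $\prod_{t=1}^p\prod_{j=1}^{b_t}L^{a_{t,j}}_{\mathbf b_1^{t-1}+j}\cdot T_{x'_1}\cdots T_{x'_p}$, where $x'_t$ is $x_t$ with each $s_i$ replaced by $s_{i+\mathbf b_1^{t-1}}$. *)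

(* Defs.v *)
From HB Require Import structures.
From mathcomp Require Import all_boot all_order all_algebra all_fingroup.
Set Implicit Arguments. Unset Strict Implicit. Unset Printing Implicit Defensive.
Import GRing.Theory.
Local Open Scope ring_scope.

(* Simple transposition s_i (1 <= i < n) of {0,...,n-1}: swaps the     *)
(* points i-1 and i (0-based).                                         *)
Definition sgen (n i : nat) : 'S_n :=
  match n as m return 'S_m with
  | 0 => 1%g
  | m.+1 => tperm (inord i.-1 : 'I_m.+1) (inord i)
  end.

Definition wprod (n : nat) (ws : seq nat) : 'S_n := (\prod_(i <- ws) sgen n i)%g.

Definition is_word (n : nat) (ws : seq nat) : bool := all (fun i => 0 < i < n)%N ws.

Definition reduced_word (n : nat) (ws : seq nat) : Prop :=
  is_word n ws /\
  forall ws', is_word n ws' -> wprod n ws' = wprod n ws -> (size ws <= size ws')%N.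

(* x' : x with each s_i replaced by s_(i+k), as an element of 'S_n
   (x acts on the points k, ..., k+m-1).  The fallback branches are never
   used when k + m <= n. *)
Definition shiftf (m n k : nat) (x : 'S_m) (y : 'I_n) : 'I_n :=
  if (k + m <= n)%N && (k <= y)%N then
    match (insub (y - k)%N : option 'I_m) with
    | Some z => insubd y (k + x z)%N
    | None => y
    end
  else y.

Definition shiftp (m n k : nat) (x : 'S_m) : 'S_n :=
  odflt 1%g (insub [ffun y => shiftf k x y] : option {perm 'I_n}).

Section AK.
Variables (R : comUnitRingType) (A : algType R).
Variables (q : R) (T : nat -> A).

(* JM k = L_(k+1) ; L k = L_k (1-based) *)
Fixpoint JM (k : nat) : A :=
  if k is k'.+1 then q^-1 *: (T k * JM k' * T k) else T 0%N.
Definition L (k : nat) : A := JM k.-1.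

Definition AK_relations (Qs : seq R) (m : nat) : Prop :=
  [/\ \prod_(x <- Qs) (T 0%N - x%:A) = 0,
      forall i, (0 < i < m)%N -> (T i - q%:A) * (T i + 1) = 0,
      T 0%N * T 1%N * T 0%N * T 1%N = T 1%N * T 0%N * T 1%N * T 0%N,
      forall i, (0 < i)%N -> (i.+2 <= m)%N -> T i * T i.+1 * T i = T i.+1 * T i * T i.+1
    & forall i j, (i < m)%N -> (j < m)%N -> (i.+1 < j)%N -> T i * T j = T j * T i].

Definition Tw_spec (m : nat) (Tw : 'S_m -> A) : Prop :=
  forall ws, reduced_word m ws -> Tw (wprod m ws) = \prod_(i <- ws) T i.

Definition AK_basis_el (m s : nat) (Tw : 'S_m -> A)
    (i : {ffun 'I_m -> 'I_s} * 'S_m) : A :=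
  (\prod_(j < m) L j.+1 ^+ i.1 j) * Tw i.2.

Definition AK_is_basis (m s : nat) (Tw : 'S_m -> A) : Prop :=
  forall x : A, exists! c : {ffun {ffun 'I_m -> 'I_s} * 'S_m -> R},
    x = \sum_i c i *: AK_basis_el Tw i.

Definition is_trivial_index (m s : nat) (i : {ffun 'I_m -> 'I_s} * 'S_m) : bool :=
  [forall j, val (i.1 j) == 0%N] && (i.2 == 1%g).

Definition Tr_spec (m s : nat) (Tw : 'S_m -> A) (Tr : A -> R) : Prop :=
  (forall (c : R) (x y : A), Tr (c *: x + y) = c * Tr x + Tr y) /\
  (forall i : {ffun 'I_m -> 'I_s} * 'S_m, Tr (AK_basis_el Tw i) = (is_trivial_index i)%:R).

Variables (eps : R) (p d : nat) (Q : 'I_d -> R).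

Definition AK_params : seq R := [seq eps ^+ s * Q i | s <- iota 1 p, i <- enum 'I_d].

Definition Ls (s k : nat) : A := \prod_(i < d) (L k - (eps ^+ s * Q i)%:A).

Definition Iset (i j : nat) : seq nat :=
  if (i <= j)%N then iota i (j - i).+1 else iota 1 j ++ iota i (p - i).+1.

Definition Lij (i j l m : nat) : A :=
  \prod_(l <= k < m.+1) \prod_(s <- Iset i j) Ls s k.

Definition Lsr (s l m : nat) : A := Lij s s l m.

End AK.

Definition Comp (p n : nat) (b : seq nat) : bool := (size b == p) && (sumn b == n).

Definition bpart (b : seq nat) (t : nat) : nat := nth 0%N b t.-1.

Definition bsum (b : seq nat) (i j : nat) : nat :=
  if (i <= j)%N then (\sum_(i <= t < j.+1) bpart b t)%N else 0%N.

Definition wab (a b : nat) : seq nat := flatten (nseq b (rev (iota 1 (a + b - 1)))).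
Definition wabk (k a b : nat) : seq nat := map (addn k) (wab a b).

Section Elements.
Variables (R : comUnitRingType) (A : algType R).
Variables (q : R) (T : nat -> A) (eps : R) (p d n : nat) (Q : 'I_d -> R).
Variables (Tw : 'S_n -> A) (b : seq nat).

Definition Tab (a c : nat) : A := Tw (wprod n (wab a c)).

Definition w_b : 'S_n :=
  (\prod_(t <- rev (iota 1 (p - 1)))
     wprod n (wabk (bsum b 1 t.-1) (bpart b t) (bsum b t.+1 p)))%g.

Definition T_b : A := Tw w_b.

Definition v_b : A :=
  (\prod_(t <- rev (iota 2 (p - 1)))
      (Lij q T eps p Q 1 t.-1 1 (bpart b t) * Tab (bpart b t) (bsum b 1 t.-1)))
  * \prod_(t <- iota 2 (p - 1)) Lsr q T eps p Q t 1 (bsum b 1 t.-1).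

(* index set of the standard basis of H_{d,b}: for each factor t (0-based),
   exponents a_{t,.} in [0,d) and x_t in S_{b_t} *)
Definition Hdb_index : finType :=
  {dffun forall t : 'I_p, ({ffun 'I_(nth 0%N b t) -> 'I_d} * 'S_(nth 0%N b t))%type}.

Definition Theta_el (i : Hdb_index) : A :=
  (\prod_(t < p) \prod_(j < nth 0%N b t) L q T (bsum b 1 t + j.+1) ^+ (i t).1 j)
  * \prod_(t < p) Tw (shiftp n (bsum b 1 t) (i t).2).

(* elements of H_{d,b} are given by their coordinates c in the standard basis *)
Definition Theta_b (c : Hdb_index -> R) : A := \sum_i c i *: Theta_el i.

Definition Tr_b (c : Hdb_index -> R) : R :=
  \sum_i c i * ([forall t, [forall j, val ((i t).1 j) == 0%N] && ((i t).2 == 1%g)])%:R.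

End Elements.

(* Main.v *)
Require Import Defs.
From HB Require Import structures.
From mathcomp Require Import all_boot all_order all_algebra all_fingroup zify ring.
Import GRing.Theory.
Local Open Scope ring_scope.

(* Induction on the number k of blocks. Write m = b_1 + ... + b_k and
   c = b_(k+1). After multiplication by the product F_k of the L^(s)_(1,m) with
   s > k, the first k factors of v_b, the basis element and T_(w_b) combine to
   F_k y, where y involves L_1, ..., L_m with exponents < kd and T_z with z in
   S_m, and Tr y is a constant times the trace of the basis element. For the
   step, T_(c,m) is moved through the Jucys-Murphy elements: this gives a
   leading term with the variables permuted, and terms T_t with t shorter than
   w_(c,m). The exponents of L_1, ..., L_c can be reduced below d because
   F_(k+1) L^(1,k)_(1,c) L^(k+1)_1 = 0 by the order relation of T_0. A
   comparison of inversion sets shows that the shorter terms have trace 0. No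
   symmetry of Tr is needed. *)

(** [Tr] can be read only on normal forms: on [ev g * Tw z] with all degrees < r it is a product of
    constant coefficients times [z = 1]. This shapes two kinds of bookkeeping. Degrees: the
    corrections produced by moving T_(c,m) can have degree (k+1)d - 1 in L_1, ..., L_c, and the
    factor L^(1,k)_(1,c) adds kd, which may exceed r; once they are cut below d, the total is again
    < (k+1)d <= r. Permutations: cutting degrees multiplies on the left by T_i with i < c, so
    knowing that a permutation differs from 1 would not survive; the property carried along is to
    lie outside S_c, which is stable under left multiplication by S_c. The annihilation behind the
    cut holds because F_(k+1), L^(1,k) and L^(k+1) together list each parameter exactly once in the
    variable L_1 = T_0. The constant is never evaluated: the case h = 1 identifies it with Tr(v_b
    T_b), whatever its value. *)

Set Implicit Arguments. Unset Strict Implicit. Unset Printing Implicit Defensive.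

(** * Inversions, descents and parabolic subgroups of the symmetric group *)

Section Permutations.

Local Open Scope nat_scope.

Variable N : nat.
Notation n := N.+1.
Implicit Types (x y z w : 'S_n) (i j k : nat).

Definition invset z : {set 'I_n * 'I_n} :=
  [set ij : 'I_n * 'I_n | (ij.1 < ij.2)%N && (z ij.2 < z ij.1)%N].

Definition inv z : nat := #|invset z|.

(** Products of permutations act from left to right, so [sgen n i * z] exchanges the values of [z]
    at [i.-1] and [i]: this is the condition for left multiplication by s_i to lengthen [z]. *)
Definition before z i : bool := (z (inord i.-1) < z (inord i))%N.

Definition fixes_from m z := forall j : 'I_n, (m <= j)%N -> z j = j.

Lemma sgenE i (j : 'I_n) : (0 < i < n)%N ->
  sgen n i j = (if j == i.-1 :> nat then i else
                if j == i :> nat then i.-1 else j) :> nat.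
Proof.
move=> /andP[i0 iN]; rewrite /sgen permE /=.
have i1 : (i.-1 < n)%N by lia.
rewrite -!(inj_eq val_inj) /= !inordK //.
by case: ifP => _; rewrite ?inordK //; case: ifP => _; rewrite ?inordK.
Qed.

Lemma sgenK i : involutive (sgen n i).
Proof. by move=> j; rewrite /sgen tpermK. Qed.

Lemma sgen2 i : (sgen n i * sgen n i = 1)%g.
Proof. by rewrite /sgen tperm2. Qed.

Lemma before_sgen i z : (0 < i < n)%N -> before (sgen n i * z)%g i = ~~ before z i.
Proof.
move=> iN; rewrite /before !permM /sgen tpermL tpermR -leqNgt [RHS]leq_eqVlt.
suff /negPf -> : (z (inord i) != z (inord i.-1) :> nat) by [].
by rewrite (inj_eq val_inj) (inj_eq perm_inj) -(inj_eq val_inj) /= !inordK; lia.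
Qed.

(** s_i keeps the order of every pair of positions except (i-1, i), so it transports the inversions
    of [z] and creates exactly that pair. *)
Lemma inv_sgen i z : (0 < i < n)%N -> before z i -> inv (sgen n i * z)%g = (inv z).+1.
Proof.
move=> iN bi; have [i1 i2] : (i.-1 < n)%N /\ (i < n)%N by lia.
pose a : 'I_n := inord i.-1; pose b : 'I_n := inord i.
have aE : a = i.-1 :> nat by rewrite inordK.
have bE : b = i :> nat by rewrite inordK.
pose f (jk : 'I_n * 'I_n) := (sgen n i jk.1, sgen n i jk.2).
have fK : involutive f by move=> [j k]; rewrite /f /= !sgenK.
have fab (jk : 'I_n * 'I_n) : jk != (a, b) -> (jk.1 < jk.2)%N -> (f jk).1 < (f jk).2.
  case: jk => j k /= ne jk; rewrite /f /= !sgenE //.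
  have: ~ (j = i.-1 :> nat /\ k = i :> nat).
    by case=> ja kb; case/eqP: ne; congr pair; apply: val_inj; rewrite /= ?aE ?bE.
  by repeat case: eqP => ?; lia.
have zab : (z a < z b)%N by [].
suff invE : invset (sgen n i * z) = (a, b) |: f @: invset z.
  rewrite /inv invE cardsU1 card_imset; last exact: inv_inj.
  suff -> : (a, b) \notin f @: invset z by [].
  apply/imsetP=> -[jk]; rewrite inE => /andP[jk1 _] /(congr1 f).
  rewrite fK /f /= /sgen tpermL tpermR => /esym E.
  by rewrite E /= in jk1; move: jk1; rewrite aE bE; lia.
apply/setP=> jk; rewrite !inE; have [->|ne] := eqVneq jk (a, b) => /=.
  by rewrite !permM /sgen tpermL tpermR zab andbT aE bE; lia.
have -> : (jk \in f @: invset z) = (f jk \in invset z).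
  by rewrite -{1}[jk]fK mem_imset //; exact: inv_inj.
rewrite inE !permM; have [fE|ne'] := eqVneq (f jk) (a, b).
  have -> : jk = (b, a) by rewrite -[jk]fK fE /f /sgen tpermL tpermR.
  rewrite /f /sgen /= !tpermL !tpermR [RHS]andbC ltnNge ltnW; last by rewrite aE bE; lia.
  by rewrite ltnNge ltnW.
congr andb; apply/idP/idP; first exact: fab.
by move=> fjk; have := fab _ ne' fjk; rewrite fK.
Qed.

Lemma inv_sgen_desc i z : (0 < i < n)%N -> ~~ before z i ->
  inv z = (inv (sgen n i * z)%g).+1.
Proof.
move=> iN nbi; rewrite -(@inv_sgen i) ?before_sgen //.
by rewrite mulgA sgen2 mul1g.
Qed.

Lemma inv_sgen_le i z : (0 < i < n)%N -> inv (sgen n i * z)%g <= (inv z).+1.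
Proof.
move=> iN; case: (boolP (before z i)) => bi; first by rewrite inv_sgen.
by rewrite (inv_sgen_desc iN bi); lia.
Qed.

Lemma inv1 : inv 1 = 0.
Proof.
by apply/eqP; rewrite cards_eq0; apply/eqP/setP => ij; rewrite !inE !perm1; lia.
Qed.

Lemma perm_increasing1 z :
  (forall i, 0 < i < n -> before z i) -> z = 1%g.
Proof.
move=> inc.
have incr i j : i < j < n -> z (inord i) < z (inord j).
  elim: j => // j IH /andP[ij jn].
  have zj : z (inord j) < z (inord j.+1) by apply: (inc j.+1).
  have [->//|ij'] := eqVneq i j.
  by apply: (ltn_trans _ zj); apply: IH; lia.
have ge (i : nat) : i < n -> i <= z (inord i).
  elim: i => // i IH iN.
  by apply: leq_ltn_trans (IH (ltnW iN)) (incr _ _ _); rewrite ltnSn.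
have le k (i : nat) : i + k.+1 = n -> z (inord i) <= i.
  elim: k i => [|k IH] i ik; first by have := ltn_ord (z (inord i)); lia.
  have := IH i.+1; have := incr i i.+1; lia.
apply/permP => j; rewrite perm1; apply: val_inj; apply/eqP; rewrite eqn_leq.
have jN := ltn_ord j.
have := ge j jN; have := le (n - j.+1) j; rewrite inord_val => h1 ->.
by rewrite andbT; apply: h1; lia.
Qed.

(** Induction along a reduced word; [before z i] is kept in the step because it is the condition
    under which T_i can be absorbed into [Tw]. *)
Lemma perm_descent_ind (P : 'S_n -> Prop) :
  P 1%g ->
  (forall i z, 0 < i < n -> before z i -> P z -> P (sgen n i * z)%g) ->
  forall z, P z.
Proof.
move=> P1 Ps z; move: {2}(inv z) (erefl (inv z)) => k; elim: k z => [|k IH] z kz.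
  rewrite (@perm_increasing1 z) // => i iN; apply/idPn => nb.
  by have := inv_sgen_desc iN nb; rewrite kz.
have [i /andP[iN nb]|noi] := pickP (fun i : 'I_n => (0 < i) && ~~ before z i); last first.
  rewrite (@perm_increasing1 z) // => i /andP[i0 iN].
  by have /= := noi (Ordinal iN); rewrite i0 /= => /negbFE.
have iN' : 0 < i < n by rewrite iN ltn_ord.
rewrite -[z]mul1g -(sgen2 i) -mulgA; apply: Ps => //.
  by rewrite before_sgen.
by apply: IH; have := inv_sgen_desc iN' nb; rewrite kz => -[].
Qed.

Lemma sgen_fix i (j : 'I_n) : 0 < i < n -> j != i.-1 :> nat -> j != i :> nat ->
  sgen n i j = j.
Proof.
by move=> iN /negPf j1 /negPf j2; apply: val_inj; rewrite /= sgenE // j1 j2.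
Qed.

Lemma fixes_from1 m : fixes_from m 1.
Proof. by move=> j; rewrite perm1. Qed.

Lemma fixes_fromM m x y : fixes_from m x -> fixes_from m y -> fixes_from m (x * y).
Proof. by move=> fx fy j mj; rewrite permM fx // fy. Qed.

Lemma fixes_fromV m z : fixes_from m z -> fixes_from m z^-1%g.
Proof. by move=> fz j mj; apply: (@perm_inj _ z); rewrite permKV fz. Qed.

Lemma fixes_from_sgen m i : 0 < i < n -> i < m -> fixes_from m (sgen n i).
Proof. by move=> iN im j mj; apply: sgen_fix => //; lia. Qed.

Lemma fixes_from_le m m' z : m <= m' -> fixes_from m z -> fixes_from m' z.
Proof. by move=> mm fz j mj; apply: fz; lia. Qed.

Lemma fixes_from_n z : fixes_from n z.
Proof. by move=> j; have := ltn_ord j; lia. Qed.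

Lemma fixes_from_lt m z (j : 'I_n) : fixes_from m z -> (z j < m) = (j < m).
Proof.
move=> fz; apply/idP/idP => h; rewrite ltnNge; apply/negP => mj.
  by move: h; rewrite (fz _ mj); lia.
have /perm_inj E := fz _ mj; by move: mj; rewrite E; lia.
Qed.

(** Reduced words of elements of the parabolic subgroup on [l, m) use only its letters: if [i.-1] or
    [i] lay outside, the product would fix that point and keep the other one on its side, so it
    could not have a descent at [i]. *)
Lemma descent_in_support l m i z : 0 < i < n -> before z i ->
  (forall j : 'I_n, ~~ (l <= j < m) -> (sgen n i * z)%g j = j) ->
  (l < i < m) /\ (forall j : 'I_n, ~~ (l <= j < m) -> z j = j).
Proof.
move=> iN; have [i1 i2] : (i.-1 < n)%N /\ (i < n)%N by lia.
rewrite /before => bi fz.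
have lim : l < i < m.
  apply/idPn => nlim.
  have fa := fz (inord i.-1); have fb := fz (inord i).
  move: fa fb bi; rewrite !permM /sgen tpermL tpermR !inordK //.
  move=> fa fb.
  have mono (j : 'I_n) : (l <= j < m) = (l <= (sgen n i * z)%g j < m).
    apply/idP/idP => h; apply/idPn => h'.
      have /perm_inj E := fz _ h'; by move: h'; rewrite E h.
    by move: h; rewrite fz // (negPf h').
  have := mono (inord i.-1); have := mono (inord i).
  rewrite !permM /sgen tpermL tpermR !inordK //.
  case: (boolP (l <= i < m)) fb => hb fb; case: (boolP (l <= i.-1 < m)) fa => ha fa.
  - by move: ha hb nlim; lia.
  - by rewrite fa // !inordK //; lia.
  - by rewrite fb // !inordK //; lia.
  - by rewrite fa // fb // !inordK //; lia.
split=> // j nj; rewrite -[RHS](fz _ nj) permM sgen_fix //; lia.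
Qed.

End Permutations.

(** * Reduced words, the block swaps w_(a,b), and shifted permutations *)

Section Words.

Local Open Scope nat_scope.
Variable N : nat.
Notation n := N.+1.
Implicit Types (x y z w : 'S_n) (i j k : nat) (ws : seq nat).

Lemma wprod_cons i ws : wprod n (i :: ws) = (sgen n i * wprod n ws)%g.
Proof. by rewrite /wprod big_cons. Qed.

Lemma wprod_nil : wprod n [::] = 1%g.
Proof. by rewrite /wprod big_nil. Qed.

Lemma wprod_cat ws ws' : wprod n (ws ++ ws') = (wprod n ws * wprod n ws')%g.
Proof. by rewrite /wprod big_cat. Qed.

Lemma inv_wprod_le ws : is_word n ws -> inv (wprod n ws) <= size ws.
Proof.
elim: ws => [_|i ws IH /= /andP[iN wws]]; first by rewrite wprod_nil inv1.
by rewrite wprod_cons; apply: leq_trans (inv_sgen_le _ iN) _; rewrite ltnS IH.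
Qed.

(** [Tw_spec] speaks of words of minimal size; the inversion number bounds the size from below,
    which turns minimality into a count. *)
Lemma reduced_wordP ws :
  is_word n ws -> size ws = inv (wprod n ws) -> reduced_word n ws.
Proof. by move=> wws sws; split=> // ws' wws' E; rewrite sws -E inv_wprod_le. Qed.

Lemma reduced_word_exists z :
  exists ws, [/\ is_word n ws, wprod n ws = z & size ws = inv z].
Proof.
elim/perm_descent_ind: z => [|i z iN bi [ws [wws Ez sz]]].
  by exists [::]; rewrite wprod_nil inv1.
by exists (i :: ws); rewrite wprod_cons Ez inv_sgen //= iN wws sz.
Qed.

Lemma cycle_wordE k a (j : 'I_n) : k + a < n ->
  wprod n (map (addn k) (rev (iota 1 a))) j =
  (if k <= j <= k + a then (if j == k + a :> nat then k else j.+1) else j) :> nat.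
Proof.
elim: a j => [|a IH] j kan.
  by rewrite wprod_nil perm1 addn0; repeat case: ifP => ?; lia.
rewrite -[a.+1]addn1 iotaD rev_cat /= wprod_cons permM IH; last by lia.
have iN : 0 < k + (1 + a) < n by lia.
by have := sgenE j iN; move: (sgen n _ j) => y; repeat (case: ifP => ?); lia.
Qed.

Lemma wabkE k a b (j : 'I_n) : k + a + b <= n ->
  wprod n (wabk k a b) j =
  (if k <= j < k + a then j + b else
   if k + a <= j < k + a + b then j - a else j) :> nat.
Proof.
move=> kab; have [ab0|ab0] := posnP (a + b).
  have [-> ->] : a = 0 /\ b = 0 by lia.
  by rewrite /wabk /wab /= wprod_nil perm1; repeat (case: ifP => ?); lia.
(* One word of [cycle_wordE] is a cycle on a + b consecutive points; its e-th power is the rotation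
   by e, and e = b is the block swap. *)
have E e : e <= a + b -> wprod n (map (addn k) (flatten (nseq e (rev (iota 1 (a + b - 1)))))) j =
  (if k <= j < k + (a + b) then
     (if j + e < k + (a + b) then j + e else j + e - (a + b)) else j) :> nat.
  elim: e => [|e IH] eab.
    by rewrite wprod_nil perm1; repeat (case: ifP => ?); lia.
  rewrite -[e.+1]addn1 nseqD flatten_cat map_cat wprod_cat /= cats0 permM.
  rewrite cycle_wordE; last by lia.
  by move: (wprod _ _ _) (IH (ltnW eab)) => y; repeat (case: ifP => ?); lia.
rewrite /wabk /wab E; last by lia.
by repeat (case: ifP => ?); lia.
Qed.

Lemma wabE a b (j : 'I_n) : a + b <= n ->
  wprod n (wab a b) j =
  (if j < a then j + b else if j < a + b then j - a else j) :> nat.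
Proof.
move=> ab; have := @wabkE 0 a b j; rewrite /wabk map_id_in // => -> //.
by rewrite add0n; repeat (case: ifP => ?); lia.
Qed.

Lemma wab_mulK a b : a + b <= n -> (wprod n (wab a b) * wprod n (wab b a) = 1)%g.
Proof.
move=> ab; apply/permP => j; rewrite perm1 permM; apply: val_inj => /=.
rewrite wabE; last by lia.
by move: (wprod _ _ _) (wabE j ab) => y; repeat (case: ifP => ?); lia.
Qed.

Lemma fixes_from_wab a b : a + b <= n -> fixes_from (a + b) (wprod n (wab a b)).
Proof.
by move=> ab j abj; apply: val_inj; rewrite /= wabE //; repeat (case: ifP => ?); lia.
Qed.

(** [shiftf] is injective, so the default 1 in [shiftp] is not taken. *)
Lemma shiftpE m k (x : 'S_m) (j : 'I_n) : k + m <= n ->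
  shiftp n k x j = shiftf k x j.
Proof.
move=> kmn; rewrite /shiftp.
suff inj : injectiveb [ffun y : 'I_n => shiftf k x y].
  by rewrite insubT /= -pvalE /= ffunE.
apply/injectiveP => y y'; rewrite !ffunE /shiftf kmn /=.
have val_lt (z : 'I_m) : k + x z < n by have := ltn_ord (x z); lia.
case: (leqP k y) => ky; case: (leqP k y') => ky' //; do ?case: insubP => //=.
- move=> u hu Eu v hv Ev /(congr1 val); rewrite !val_insubd !val_lt => /addnI.
  move=> /val_inj /perm_inj uv; apply: val_inj => /=.
  by move: Eu Ev; rewrite uv; lia.
- move=> h u hu Eu /(congr1 val); rewrite val_insubd val_lt /= => E.
  by have := ltn_ord (x u); lia.
- move=> u hu Eu h /(congr1 val); rewrite val_insubd val_lt /= => E.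
  by have := ltn_ord (x u); lia.
- by move=> u hu Eu /(congr1 val); rewrite val_insubd val_lt /=; lia.
- by move=> u hu Eu /(congr1 val); rewrite val_insubd val_lt /=; lia.
Qed.

Lemma shiftp_out m k (x : 'S_m) (j : 'I_n) : k + m <= n ->
  ~~ (k <= j < k + m) -> shiftp n k x j = j.
Proof.
move=> kmn nj; rewrite shiftpE // /shiftf; case: ifP => // /andP[_ kj].
by case: insubP => // u hu _; move: nj hu; lia.
Qed.

Lemma shiftp_eq1 m k (x : 'S_m) : k + m <= n -> (shiftp n k x == 1%g) = (x == 1%g).
Proof.
move=> kmn; have val_lt (z : 'I_m) : k + z < n by have := ltn_ord z; lia.
have E (j : 'I_m) : shiftp n k x (Ordinal (val_lt j)) = k + x j :> nat.
  rewrite shiftpE // /shiftf kmn /= leq_addr; case: insubP => [u hu Eu|] /=; last first.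
    by have := ltn_ord j; lia.
  by rewrite val_insubd val_lt; congr (_ + x _); apply: val_inj; move: Eu => /=; lia.
apply/eqP/eqP => x1.
  apply/permP => j; apply: val_inj; apply: (@addnI k).
  by rewrite -E x1 !perm1.
apply/permP => j; rewrite [RHS]perm1.
have [j1|j2] := boolP (k <= j < k + m); last exact: shiftp_out.
have jm : j - k < m by lia.
have jE : j = Ordinal (val_lt (Ordinal jm)) by apply: val_inj => /=; lia.
by apply: val_inj; rewrite /= {1}jE E x1 perm1 /=; lia.
Qed.

End Words.

(** * Minimal coset representatives and the permutation w_b *)

Section Blocks.

Local Open Scope nat_scope.
Variable N : nat.
Notation n := N.+1.
Implicit Types (x y z w : 'S_n) (i j k m c : nat).

Definition supported_in l m z := forall j : 'I_n, ~~ (l <= j < m) -> z j = j.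

Definition increasing_on l m z :=
  forall i j : 'I_n, l <= i -> i < j -> j < m -> z i < z j.

Lemma fixes_from_supported m z : fixes_from m z -> supported_in 0 m z.
Proof. by move=> fz j jm; apply: fz; lia. Qed.

Lemma supported_lt l m z (j : 'I_n) : supported_in l m z ->
  (l <= z j < m) = (l <= j < m).
Proof.
move=> fz; apply/idP/idP => h; apply/idPn => h'; last first.
  by have /perm_inj E := fz _ h'; move: h'; rewrite E h.
by move: h; rewrite fz // (negPf h').
Qed.

Lemma increasing_wab_l m c : m + c <= n -> increasing_on 0 m (wprod n (wab m c)).
Proof. by move=> mc i j _ ij jm; rewrite !wabE //; repeat (case: ifP => ?); lia. Qed.

Lemma increasing_wab_r m c : m + c <= n -> increasing_on m (m + c) (wprod n (wab m c)).
Proof. by move=> mc i j mi ij jm; rewrite !wabE //; repeat (case: ifP => ?); lia. Qed.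

Lemma increasing_mul_fix l m z w : (forall j : 'I_n, l <= j < m -> z j = j) ->
  increasing_on l m w -> increasing_on l m (z * w).
Proof.
move=> fz iw i j li ij jm; rewrite !permM.
by rewrite (fz i) ?(fz j) ?iw //; lia.
Qed.

(** The inversions of w_(c,m) are the pairs i < c <= j < c + m. Up to S_c, [z] is the inverse of
    [u]: it sends the points below c into [m, m+c) and those of [c, c+m) below m, so each such pair
    is an inversion of [z]. *)
Lemma inv_wab_le c m x z (u : 'S_n) : c + m <= n -> fixes_from c x ->
  (forall a : 'I_n, (u a < c) = (m <= a < m + c)) ->
  (forall a : 'I_n, (c <= u a < c + m) = (a < m)) ->
  (x * z * u = 1)%g -> inv (wprod n (wab c m)) <= inv z.
Proof.
move=> cm fx u1 u2 xzu.
have ev (j : 'I_n) : u (z (x j)) = j by rewrite -[RHS](perm1 j) -xzu !permM.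
apply: subset_leq_card; apply/subsetP => -[i j].
rewrite !inE /= !wabE // => /andP[ij].
move=> ji; have [ic cj] : i < c /\ c <= j < c + m.
  by move: ji; repeat (case: ifP => ?); lia.
rewrite ij /=.
have : z j < m.
  by rewrite -u2; move: (ev j); rewrite fx ?(andP cj).1 // => ->.
have : m <= z i < m + c.
  rewrite -u1; have := ev (x^-1 i)%g; rewrite permKV => ->.
  by rewrite -(fixes_from_lt _ fx) permKV.
by lia.
Qed.

Variable b : seq nat.
Notation M := (bsum b 1).

Lemma bsumS k : M k.+1 = M k + nth 0 b k.
Proof.
rewrite /bsum /=; case: k => [|k]; first by rewrite big_nat1.
by rewrite big_nat_recr.
Qed.

Lemma bsum_leq k l : k <= l -> M k <= M l.
Proof.
move=> kl; rewrite -(subnKC kl); elim: (l - k) => [|e IH]; first by rewrite addn0.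
by rewrite addnS bsumS; lia.
Qed.

Lemma bsum_sumn k : k <= size b -> M k = sumn (take k b).
Proof.
elim: k => [|k IH] kb; first by rewrite take0.
by rewrite bsumS IH ?(take_nth 0) ?sumn_rcons // ltnW.
Qed.

Lemma bsum_sub i j : i <= j -> bsum b i.+1 j = M j - M i.
Proof.
move=> ij; rewrite -(subnKC ij); elim: (j - i) => [|e IH].
  by rewrite addn0 /bsum ltnn subnn.
rewrite addnS bsumS.
have -> : bsum b i.+1 (i + e).+1 = bsum b i.+1 (i + e) + nth 0 b (i + e).
  rewrite /bsum ltnS leq_addr; case: e IH => [|e] _.
    by rewrite addn0 ltnn big_nat1.
  by rewrite addnS ltnS leq_addr big_nat_recr //=; lia.
by rewrite IH; have := @bsum_leq i (i + e) (leq_addr _ _); lia.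
Qed.

Lemma block_exists k j : j < M k -> exists2 t, t < k & M t <= j < M t.+1.
Proof.
elim: k => // k IH jk; have [kj|jk'] := leqP (M k) j.
  by exists k => //; rewrite kj jk.
by have [t tk tj] := IH jk'; exists t => //; exact: leqW.
Qed.

(** w_b built from the other end: each new block b_(k'+1) is swapped with all earlier ones, so that
    the first k factors concern the first k blocks only, as the induction on k requires. *)
Fixpoint block_reversal k : 'S_n :=
  if k is k'.+1 then
    (block_reversal k' * wprod n (wab (M k') (nth 0 b k')))%g
  else 1%g.

Lemma fixes_from_block_reversal k : M k <= n -> fixes_from (M k) (block_reversal k).
Proof.
elim: k => [|k IH] kn /=; first exact: fixes_from1.
have := bsumS k => E; apply: fixes_fromM.
  by apply: fixes_from_le (IH _); lia.
by rewrite E; apply: fixes_from_wab; lia.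
Qed.

Lemma block_reversalE k t (j : 'I_n) : M k <= n -> t < k -> M t <= j < M t.+1 ->
  block_reversal k j = M k - M t.+1 + (j - M t) :> nat.
Proof.
elim: k => // k IH kn tk tj /=; have E := bsumS k.
rewrite permM wabE; last by lia.
have ML := @bsum_leq t.+1 k; have [tk'|tk'] := eqVneq t k.
  rewrite tk' in tj *; rewrite fixes_from_block_reversal; [|lia|lia].
  by repeat (case: ifP => ?); lia.
by rewrite IH; [repeat (case: ifP => ?); lia|lia|lia|lia].
Qed.

(** Both sides reverse the order of the blocks and keep the order inside each block. *)
Lemma w_bE p : size b = p -> sumn b = n -> block_reversal p = w_b p n b.
Proof.
move=> bp bn; have Mp : M p = n by rewrite bsum_sumn ?bp // -bp take_size.
have p0 : 0 < p by case: p bp Mp.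
(* The factors t = p-1, ..., p-e of [w_b]: together they reverse the last e + 1 blocks and fix all
   points before them. *)
pose U e : 'S_n := (\prod_(t <- rev (iota (p - e) e))
     wprod n (wabk (bsum b 1 t.-1) (bpart b t) (bsum b t.+1 p)))%g.
have UE e (j : 'I_n) : e < p ->
    (j < M (p - e.+1) -> U e j = j) /\
    (forall t, p - e.+1 <= t < p -> M t <= j < M t.+1 ->
      U e j = M (p - e.+1) + (M p - M t.+1) + (j - M t) :> nat).
  elim: e j => [|e IH] j ep.
    rewrite /U big_nil perm1; split=> // t tp tj.
    have tE : t.+1 = p by lia.
    have -> : p - 1 = t by lia.
    by rewrite tE in tj *; lia.
  have [IH1 IH2] := IH j (ltnW ep).
  have -> : U e.+1 = (U e * wprod n (wabk (M (p - e.+2)) (nth 0 b (p - e.+2))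
                                 (M p - M (p - e.+1))))%g.
    rewrite /U; have -> : iota (p - e.+1) e.+1 = p - e.+1 :: iota (p - e) e.
      by rewrite /=; congr (_ :: iota _ _); lia.
    rewrite rev_cons -cats1 big_cat big_seq1 /bpart (@bsum_sub (p - e.+1)); last by lia.
    by have -> : (p - e.+1).-1 = p - e.+2 by lia.
  have E : M (p - e.+1) = M (p - e.+2) + nth 0 b (p - e.+2).
    by rewrite -bsumS; congr (bsum _ _ _); lia.
  have L1 := @bsum_leq (p - e.+1) p (leq_subr _ _).
  split=> [jl|t tp tj].
    apply: val_inj; rewrite /= permM wabkE; last by lia.
    by rewrite IH1; [repeat (case: ifP => ?); lia|lia].
  rewrite permM wabkE; last by lia.
  have L2 := @bsum_leq t.+1 p (andP tp).2.
  have [te|te] := eqVneq t (p - e.+2).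
    have te1 : t.+1 = p - e.+1 by lia.
    move: tj; rewrite te1 te => tj.
    by rewrite IH1; [repeat (case: ifP => ?); lia|lia].
  have L3 : M (p - e.+1) <= M t by apply: bsum_leq; lia.
  by rewrite (IH2 t); [repeat (case: ifP => ?); lia|lia|lia].
apply/permP => j; apply: val_inj.
have jn : j < M p by rewrite Mp.
have [t tp tj] := block_exists jn.
have [_ /(_ t)] := UE (p - 1) j ltac:(lia).
have -> : p - (p - 1).+1 = 0 by lia.
rewrite /= (@block_reversalE p t) ?Mp // => U1.
by rewrite /w_b; move: U1; rewrite /U; have -> : p - (p - 1) = 1 by [lia]; move=> -> //; lia.
Qed.

End Blocks.

(** * Linear spans as inductive predicates *)

Section LinearSpan.

Variables (R : comUnitRingType) (A : algType R).
Implicit Types (P Q : A -> Prop) (x y a : A).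

Inductive lspan P : A -> Prop :=
| lspan0 : lspan P 0
| lspan_cons c x y : P x -> lspan P y -> lspan P (c *: x + y).

Lemma lspan_gen P x : P x -> lspan P x.
Proof. by move=> Px; rewrite -[x]addr0 -[x]scale1r; apply: lspan_cons => //; exact: lspan0. Qed.

Lemma lspanD P x y : lspan P x -> lspan P y -> lspan P (x + y).
Proof.
elim=> [|c z t Pz _ IH] Py; first by rewrite add0r.
by rewrite -addrA; apply: lspan_cons => //; exact: IH.
Qed.

Lemma lspanZ P c x : lspan P x -> lspan P (c *: x).
Proof.
elim=> [|e z t Pz _ IH]; first by rewrite scaler0; exact: lspan0.
by rewrite scalerDr scalerA; apply: lspan_cons.
Qed.

Lemma lspan_sum P (I : Type) (r : seq I) (F : I -> A) :
  (forall i, lspan P (F i)) -> lspan P (\sum_(i <- r) F i).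
Proof.
move=> h; elim/big_rec: _ => [|i x _ Px]; first exact: lspan0.
exact: lspanD.
Qed.

Lemma lspan_mono P Q x : (forall y, P y -> lspan Q y) -> lspan P x -> lspan Q x.
Proof.
move=> PQ; elim=> [|c z t Pz _ IH]; first exact: lspan0.
by apply: lspanD => //; apply: lspanZ; exact: PQ.
Qed.

Lemma lspan_mull P Q a x : (forall y, P y -> lspan Q (a * y)) -> lspan P x -> lspan Q (a * x).
Proof.
move=> PQ; elim=> [|c z t Pz _ IH]; first by rewrite mulr0; exact: lspan0.
by rewrite mulrDr -scalerAr; apply: lspanD => //; apply: lspanZ; exact: PQ.
Qed.

Lemma lspan_mulr P Q a x : (forall y, P y -> lspan Q (y * a)) -> lspan P x -> lspan Q (x * a).
Proof.
move=> PQ; elim=> [|c z t Pz _ IH]; first by rewrite mul0r; exact: lspan0.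
by rewrite mulrDl -scalerAl; apply: lspanD => //; apply: lspanZ; exact: PQ.
Qed.

(** Rewriting modulo the right annihilator of [z], extended from generators to their span. *)
Lemma lspan_lift P Q z a :
  (forall x, P x -> exists2 y, lspan Q y & z * x = z * y) ->
  lspan P a -> exists2 y, lspan Q y & z * a = z * y.
Proof.
move=> PQ; elim=> [|e x y Px _ [y' sy Ey]]; first by exists 0 => //; exact: lspan0.
have [x' sx Ex] := PQ _ Px; exists (e *: x' + y').
  by apply: lspanD => //; exact: lspanZ.
by rewrite !mulrDr -!scalerAr Ex Ey.
Qed.

End LinearSpan.

(** * Commutation of the generators with the Jucys-Murphy elements *)

Section HeckeAlgebra.

Variables (R : comUnitRingType) (A : algType R) (q : R) (T : nat -> A) (N : nat).
Notation n := N.+1.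
Variable Qs : seq R.
Hypothesis q_unit : q \is a GRing.unit.
Hypothesis HAK : AK_relations q T Qs n.

Notation X := (JM q T).

Lemma T_comm i j : (i < n)%N -> (j < n)%N -> (i.+1 < j)%N -> GRing.comm (T i) (T j).
Proof. by case: HAK => _ _ _ _; apply. Qed.

Lemma T_braid i : (0 < i)%N -> (i.+2 <= n)%N ->
  T i * T i.+1 * T i = T i.+1 * T i * T i.+1.
Proof. by case: HAK => _ _ _ + _; apply. Qed.

Lemma T_sq i : (0 < i < n)%N -> T i * T i = (q - 1) *: T i + q%:A.
Proof.
case: HAK => _ T_quad _ _ _ iN; apply/eqP; rewrite -subr_eq0 -(T_quad _ iN); apply/eqP.
rewrite mulrDr mulr1 mulrBl -scalerAl mul1r.
by rewrite scalerBl scale1r !opprD opprK !addrA.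
Qed.

Lemma JMS k : X k.+1 = q^-1 *: (T k.+1 * X k * T k.+1).
Proof. by []. Qed.

Lemma comm_T_JM_gt i j : (j.+1 < i)%N -> (i < n)%N -> GRing.comm (T i) (X j).
Proof.
elim: j => [|j IH] ji iN; first by apply/commr_sym; apply: T_comm.
rewrite JMS /GRing.comm -scalerAr -scalerAl; congr (_ *: _).
have c1 : GRing.comm (T i) (T j.+1) by apply/commr_sym; apply: T_comm; lia.
by apply: commrM => //; apply: commrM => //; apply: IH; lia.
Qed.

(** The critical case is i = j - 1: in front of T_j T_(j-1), the braid relation turns T_(j-1) into
    T_j, which passes [X (j-2)] and is turned back on the other side. *)
Lemma comm_T_JM_lt i j : (0 < i < j)%N -> (j < n)%N -> GRing.comm (T i) (X j).
Proof.
elim: j => [|j IH] ij jN; first by lia.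
have [ij'|ij'] := ltnP i j.
  rewrite JMS /GRing.comm -scalerAr -scalerAl; congr (_ *: _).
  have c1 : GRing.comm (T i) (T j.+1) by apply: T_comm; lia.
  by apply: commrM => //; apply: commrM => //; apply: IH; lia.
have {ij'} -> : i = j by lia.
case: j ij jN {IH} => [|j] ij jN; first by lia.
rewrite !JMS /GRing.comm -!scalerAr -!scalerAl -!scalerAr; do 2!congr (_ *: _).
have br := @T_braid j.+1 isT ltac:(lia).
have cX : GRing.comm (T j.+2) (X j) by apply: comm_T_JM_gt.
transitivity (T j.+2 * T j.+1 * X j * (T j.+2 * T j.+1 * T j.+2)).
  by rewrite !mulrA br -(mulrA (_ * T j.+1) (T j.+2) (X j)) cX !mulrA.
by rewrite -br !mulrA.
Qed.

Lemma comm_T0_JM j : (j < n)%N -> GRing.comm (T 0%N) (X j).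
Proof.
elim: j => [|j IH] jN; first exact: commr_refl.
rewrite JMS /GRing.comm -scalerAr -scalerAl; congr (_ *: _).
(* [X 1] is q^-1 T_1 T_0 T_1, so j = 1 is the length-four braid relation. *)
case: j IH jN => [|j] IH jN; first by case: HAK => _ _ T0101 _ _; rewrite /= !mulrA T0101.
have c1 : GRing.comm (T 0%N) (T j.+2) by apply: T_comm.
by apply: commrM => //; apply: commrM => //; apply: IH; lia.
Qed.

Lemma comm_JM i j : (i < n)%N -> (j < n)%N -> GRing.comm (X i) (X j).
Proof.
wlog ij : i j / (i < j)%N => [th|] iN jN.
  case: (ltngtP i j) => [ij|ji|->]; [exact: th| |exact: commr_refl].
  by apply/commr_sym; exact: th.
elim: i ij {iN} => [|i IH] ij; first exact: comm_T0_JM.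
rewrite JMS /GRing.comm -scalerAr -scalerAl; congr (_ *: _); apply/commr_sym.
have c1 : GRing.comm (X j) (T i.+1) by apply/commr_sym; apply: comm_T_JM_lt.
apply: commrM => //; apply: commrM => //; apply/commr_sym; apply: IH; lia.
Qed.

Lemma T_JM_pred i : (i.+1 < n)%N -> T i.+1 * X i = X i.+1 * T i.+1 - (q - 1) *: X i.+1.
Proof.
move=> iN; rewrite JMS -scalerAl -(mulrA _ (T i.+1) (T i.+1)) T_sq // mulrDr -!scalerAr mulr1.
by rewrite !scalerDr !scalerA mulrC addrAC subrr add0r mulVr ?scale1r.
Qed.

Lemma T_JM_self i : (i.+1 < n)%N -> T i.+1 * X i.+1 = X i * T i.+1 + (q - 1) *: X i.+1.
Proof.
move=> iN; rewrite JMS -scalerAr !mulrA T_sq // !mulrDl -!scalerAl mul1r.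
by rewrite !scalerDr !scalerA mulVr // scale1r addrC mulrC.
Qed.

(** * The elements T_w and their products *)

Variable Tw : 'S_n -> A.
Hypothesis HTw : Tw_spec T Tw.
Implicit Types (x y z w : 'S_n) (i : nat).

Lemma Tw_1 : Tw 1 = 1.
Proof.
have := HTw (@reduced_wordP N [::] isT _).
by rewrite wprod_nil inv1 big_nil => ->.
Qed.

Lemma Tw_sgen i z : (0 < i < n)%N -> before z i -> Tw (sgen n i * z) = T i * Tw z.
Proof.
move=> iN bi; have [ws [wws Ez sz]] := reduced_word_exists z.
have sw : size (i :: ws) = inv (wprod n (i :: ws)).
  by rewrite wprod_cons Ez inv_sgen //= sz.
have wi : is_word n (i :: ws) by rewrite /= iN.
have := HTw (reduced_wordP wi sw); rewrite wprod_cons Ez big_cons => ->.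
by rewrite -Ez HTw //; apply: reduced_wordP => //; rewrite Ez.
Qed.

Lemma T_Tw_desc i z : (0 < i < n)%N -> ~~ before z i ->
  T i * Tw z = (q - 1) *: Tw z + q *: Tw (sgen n i * z)%g.
Proof.
move=> iN nb; have bi : before (sgen n i * z)%g i by rewrite before_sgen.
have E : Tw z = T i * Tw (sgen n i * z)%g by rewrite -Tw_sgen // mulgA sgen2 mul1g.
by rewrite {1}E mulrA T_sq // mulrDl -!scalerAl mul1r -E.
Qed.

Lemma T_Tw_span i z : (0 < i < n)%N ->
  lspan (fun a => exists2 y, y = z \/ y = (sgen n i * z)%g & a = Tw y) (T i * Tw z).
Proof.
move=> iN; case: (boolP (before z i)) => bi.
  by rewrite -Tw_sgen //; apply: lspan_gen; exists (sgen n i * z)%g => //; right.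
rewrite T_Tw_desc //; apply: lspanD; apply: lspanZ; apply: lspan_gen.
  by exists z => //; left.
by exists (sgen n i * z)%g => //; right.
Qed.

(** [w] is the shortest element of its coset by the parabolic subgroup on [l, m), so lengths add. *)
Lemma Tw_mul l m z w : supported_in l m z -> increasing_on l m w ->
  Tw z * Tw w = Tw (z * w)%g.
Proof.
move=> sz iw; elim/perm_descent_ind: z sz => [|i z iN bi IH] sz.
  by rewrite Tw_1 mul1r mul1g.
have [lim sz'] := descent_in_support iN bi sz.
rewrite Tw_sgen // -mulrA IH // -mulgA Tw_sgen //.
have [i1 i2] : (i.-1 < n)%N /\ (i < n)%N by lia.
have s1 := supported_lt (inord i.-1) sz'; have s2 := supported_lt (inord i) sz'.
rewrite !inordK // in s1 s2.
by rewrite /before !permM; apply: iw => //; move: s1 s2; lia.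
Qed.

Lemma Tw_prod m (P : A -> Prop) z : fixes_from m z ->
  P 1 -> (forall i a, (0 < i < n)%N -> (i < m)%N -> P a -> P (T i * a)) -> P (Tw z).
Proof.
move=> fz P1 PM; elim/perm_descent_ind: z fz => [|i z iN bi IH] fz; first by rewrite Tw_1.
have [/andP[_ im] sz'] := descent_in_support iN bi (fixes_from_supported fz).
rewrite Tw_sgen //; apply: PM => //; apply: IH => j mj; apply: sz'; lia.
Qed.

Lemma comm_Tw m a z : fixes_from m z ->
  (forall i, (0 < i < n)%N -> (i < m)%N -> GRing.comm a (T i)) -> GRing.comm a (Tw z).
Proof.
move=> fz ca; apply: Tw_prod fz _ _ => [|i y iN im cy]; first exact: commr1.
by apply: commrM => //; exact: ca.
Qed.

(* Every term of the product is governed by a permutation below [a]: this is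
   the only information on the structure constants that the trace needs. *)
Lemma Tw_Tw_span m a y : fixes_from m a ->
  lspan (fun t => exists z, [/\ fixes_from m z, z = a \/ (inv z < inv a)%N & t = Tw (z * y)%g])
    (Tw a * Tw y).
Proof.
elim/perm_descent_ind: a => [|i a iN bi IH] fa.
  by rewrite Tw_1 mul1r; apply: lspan_gen; exists 1%g; split; [|left|rewrite mul1g].
have [/andP[_ im] sz'] := descent_in_support iN bi (fixes_from_supported fa).
have fa' : fixes_from m a by move=> j mj; apply: sz'; lia.
rewrite Tw_sgen // -mulrA; apply: lspan_mull (IH fa') => _ [z [fz za ->]].
apply: lspan_mono (T_Tw_span (z * y)%g iN) => _ [t tz ->]; apply: lspan_gen.
rewrite inv_sgen //; case: tz => ->.
  by exists z; split=> //; right; case: za => [->|]; lia.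
exists (sgen n i * z)%g; split; last by rewrite mulgA.
  by apply: fixes_fromM => //; exact: fixes_from_sgen.
case: za => [->|za]; first by left.
by right; have := inv_sgen_le z iN; lia.
Qed.

(** * Polynomials in the Jucys-Murphy elements, and their exchange with T_w *)

Notation ha j := (horner_alg (X j)).

(* [X j] is the Jucys-Murphy element [L_(j+1)]. *)
Definition ev (g : 'I_n -> {poly R}) : A := \prod_(j < n) ha j (g j).

Implicit Types (f g h : 'I_n -> {poly R}) (D : 'I_n -> nat) (j : 'I_n).

(** A bound on [size] is a strict bound on the degree, matching the exponent range of the basis. *)
Definition bounded D g := forall j, (size (g j) <= D j)%N.

Lemma comm_horner_alg (a c : A) (u : {poly R}) : GRing.comm a c -> GRing.comm a (horner_alg c u).
Proof.
move=> ac; elim/poly_ind: u => [|u e IH]; first by rewrite rmorph0; exact: commr0.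
rewrite rmorphD rmorphM /= horner_algX horner_algC; apply: commrD; first exact: commrM.
by rewrite /GRing.comm -scalerAr -scalerAl mulr1 mul1r.
Qed.

Lemma comm_ha (i j : 'I_n) (u v : {poly R}) : GRing.comm (ha i u) (ha j v).
Proof.
by apply: comm_horner_alg; apply/commr_sym; apply: comm_horner_alg; exact: comm_JM.
Qed.

Lemma comm_ev (a : A) g : (forall j, GRing.comm a (X (nat_of_ord j)) \/ g j = 1) -> GRing.comm a (ev g).
Proof.
move=> ag; apply: commr_prod => j _; case: (ag j) => [ac|->]; first exact: comm_horner_alg.
by rewrite rmorph1; exact: commr1.
Qed.

Lemma eq_ev g h : g =1 h -> ev g = ev h.
Proof. by move=> gh; apply: eq_bigr => j _; rewrite gh. Qed.

Lemma ev1 : ev (fun=> 1) = 1.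
Proof. by rewrite /ev big1 // => j _; rewrite rmorph1. Qed.

Lemma evM g h : ev (fun j => g j * h j) = ev g * ev h.
Proof.
rewrite /ev -prodrM_comm; first by apply: eq_bigr => j _; rewrite rmorphM.
by move=> i j _ _; exact: comm_ha.
Qed.

Lemma ev_comm g h : GRing.comm (ev g) (ev h).
Proof. by rewrite /GRing.comm -!evM; apply: eq_ev => j; rewrite mulrC. Qed.

Definition upd g (j : 'I_n) (u : {poly R}) : 'I_n -> {poly R} := fun k => if k == j then u else g k.

Lemma ev_single (j : 'I_n) u : ev (upd (fun=> 1) j u) = ha j u.
Proof.
rewrite /ev (big_only1 j) //= /upd ?eqxx // => k /negPf -> _.
by rewrite rmorph1.
Qed.

Lemma ev_upd g j u : ev (upd g j u) = ev (upd g j 1) * ha j u.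
Proof.
rewrite -ev_single -evM; apply: eq_ev => k; rewrite /upd.
by case: ifP; rewrite ?mul1r ?mulr1.
Qed.

Lemma ev_upd_lin g j c u v :
  ev (upd g j (c *: u + v)) = c *: ev (upd g j u) + ev (upd g j v).
Proof.
rewrite ev_upd (ev_upd g j u) (ev_upd g j v) linearP /=.
by rewrite mulr_algl mulrDr -scalerAr.
Qed.

Definition upd2 g (i k : 'I_n) (u v : {poly R}) := upd (upd g k v) i u.

Lemma ev_upd2 g (i k : 'I_n) u v : i != k ->
  ev (upd2 g i k u v) = ev (upd2 g i k 1 1) * (ha i u * ha k v).
Proof.
move=> ik; rewrite -!ev_single -!evM; apply: eq_ev => j; rewrite /upd2 /upd.
have [->|_] := eqVneq j i; first by rewrite (negPf ik) mulr1 mul1r.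
by case: ifP => _; rewrite !(mul1r, mulr1).
Qed.

Lemma horner_alg_sum m (a : A) (u : {poly R}) : (size u <= m)%N ->
  horner_alg a u = \sum_(e < m) u`_e *: a ^+ e.
Proof.
move=> um; have {1}-> : u = \poly_(e < m) u`_e.
  apply/polyP => e; rewrite coef_poly; case: ltnP => // me.
  by rewrite nth_default // (leq_trans um).
rewrite poly_def rmorph_sum /=; apply: eq_bigr => e _.
by rewrite linearZ /= rmorphXn /= horner_algX mulr_algl.
Qed.

Section TwoVariables.

Variables (i : nat) (i_lt : (i.+1 < n)%N).
Notation x := (X i).
Notation y := (X i.+1).
Notation t := (T i.+1).

Let span2 m := lspan (fun a => exists u v : {poly R},
  [/\ (size u <= m)%N, (size v <= m)%N & a = ha i u * ha i.+1 v]).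

Let xy : GRing.comm x y. Proof. by apply: comm_JM => //; lia. Qed.

Let span2_monom e k m : (e < m)%N -> (k < m)%N -> span2 m (x ^+ e * y ^+ k).
Proof.
move=> em km; apply: lspan_gen; exists 'X^e, 'X^k.
by rewrite !size_polyXn !rmorphXn /= !horner_algX.
Qed.

Let span2_le m m' a : (m <= m')%N -> span2 m a -> span2 m' a.
Proof.
move=> mm; apply: lspan_mono => _ [u [v [um vm ->]]]; apply: lspan_gen.
by exists u, v; split=> //; lia.
Qed.

Let span2_mul_y m a : span2 m a -> span2 m.+1 (y * a).
Proof.
apply: lspan_mull => _ [u [v [um vm ->]]]; apply: lspan_gen.
exists u, (v * 'X); split; [lia|by apply: leq_trans (size_polyMleq _ _) _; rewrite size_polyX; lia|].
rewrite mulrA (comm_horner_alg u (commr_sym xy)) -mulrA rmorphM /= horner_algX.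
by rewrite (comm_horner_alg v (commr_refl y)).
Qed.

Let span2_mul_x m a : span2 m a -> span2 m.+1 (x * a).
Proof.
apply: lspan_mull => _ [u [v [um vm ->]]]; apply: lspan_gen.
exists (u * 'X), v; split; [by apply: leq_trans (size_polyMleq _ _) _; rewrite size_polyX; lia|lia|].
rewrite mulrA rmorphM /= horner_algX.
by rewrite (comm_horner_alg u (commr_refl x)).
Qed.

Let T_xn e : span2 e.+1 (t * x ^+ e - y ^+ e * t) /\ span2 e.+1 (t * y ^+ e - x ^+ e * t).
Proof.
elim: e => [|e [IHx IHy]]; first by rewrite !expr0 !mulr1 !mul1r subrr; split; exact: lspan0.
split.
  have -> : t * x ^+ e.+1 - y ^+ e.+1 * t =
     - (q - 1) *: (y * x ^+ e) + y * (t * x ^+ e - y ^+ e * t).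
    rewrite exprS mulrA T_JM_pred // mulrBl -(scalerAl (q - 1)) scaleNr mulrBr [y ^+ _]exprS !mulrA.
    by rewrite addrAC [RHS]addrC.
  apply: lspanD; last exact: span2_mul_y.
  apply: lspanZ; rewrite (commrX e (commr_sym xy)) -[X in _ * X]expr1; apply: span2_monom => //.
have -> : t * y ^+ e.+1 - x ^+ e.+1 * t =
     (q - 1) *: (x ^+ 0 * y ^+ e.+1) + x * (t * y ^+ e - x ^+ e * t).
  rewrite expr0 mul1r exprS mulrA T_JM_self // mulrDl -(scalerAl (q - 1)) mulrBr [x ^+ _.+1]exprS !mulrA.
  by rewrite addrAC [RHS]addrC.
apply: lspanD; last exact: span2_mul_x.
by apply: lspanZ; apply: span2_monom.
Qed.

(** With [comm_T_xDy]: [t] commutes with the symmetric polynomials in its two variables. *)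
Lemma comm_T_xy : GRing.comm t (x * y).
Proof.
rewrite /GRing.comm mulrA T_JM_pred // mulrBl -(mulrA y t y) T_JM_self //.
rewrite mulrDr -(scalerAl (q - 1)) -(scalerAr (q - 1)) addrK mulrA; congr (_ * _).
by rewrite xy.
Qed.

Lemma comm_T_xDy : GRing.comm t (x + y).
Proof.
rewrite /GRing.comm mulrDr T_JM_pred // T_JM_self // mulrDl.
by rewrite addrCA subrK.
Qed.

Let span2_mul_xy e m a : span2 m a -> span2 (e + m)%N ((x * y) ^+ e * a).
Proof.
move=> sa; elim: e => [|e IH]; first by rewrite mul1r.
rewrite exprS -mulrA addSn.
apply: lspan_mull IH => _ [u [v [um vm ->]]].
rewrite mulrA -(mulrA x) (comm_horner_alg u (commr_sym xy)); apply: lspan_gen.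
exists ('X * u), ('X * v); split.
- by apply: leq_trans (size_polyMleq _ _) _; rewrite size_polyX; lia.
- by apply: leq_trans (size_polyMleq _ _) _; rewrite size_polyX; lia.
by rewrite !rmorphM /= !horner_algX !mulrA.
Qed.

(** (xy)^min(e,k) commutes with [t], so only a pure power is really exchanged. This keeps the
    corrections at degree at most max(e,k) in each variable; moving x^e and then y^k would only
    bound it by e + k. *)
Let T_monom e k : span2 (maxn e k).+1 (t * (x ^+ e * y ^+ k) - x ^+ k * y ^+ e * t).
Proof.
have Ex (a b : A) l l' : GRing.comm a b -> a ^+ (l + l') * b ^+ l = (a * b) ^+ l * a ^+ l'.
  move=> ab; rewrite exprMn_comm // exprD -!mulrA; congr (_ * _).
  by apply: commrX; apply/commr_sym; apply: commrX; exact: commr_sym.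
have cT l : GRing.comm t ((x * y) ^+ l) by apply: commrX; exact: comm_T_xy.
have [ek|ke] := leqP e k.
  rewrite -(subnKC ek); set l := (k - e)%N.
  have -> : x ^+ e * y ^+ (e + l) = (x * y) ^+ e * y ^+ l.
    rewrite xy -(Ex y x) ?(commr_sym xy) //.
    by apply: commrX; apply/commr_sym; apply: commrX; exact: commr_sym.
  rewrite (Ex x y) // mulrA cT -!mulrA -mulrBr.
  apply: span2_le (span2_mul_xy e (T_xn l).2); lia.
rewrite -(subnKC (ltnW ke)); set l := (e - k)%N.
have -> : x ^+ k * y ^+ (k + l) = (x * y) ^+ k * y ^+ l.
  rewrite xy -(Ex y x) ?(commr_sym xy) //.
  by apply: commrX; apply/commr_sym; apply: commrX; exact: commr_sym.
rewrite (Ex x y) // mulrA cT -!mulrA -mulrBr.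
apply: span2_le (span2_mul_xy k (T_xn l).1); lia.
Qed.

Lemma T_ha_ha (u v : {poly R}) m : (size u <= m)%N -> (size v <= m)%N ->
  span2 m (t * (ha i u * ha i.+1 v) - ha i v * ha i.+1 u * t).
Proof.
move=> um vm.
have prodE (a b : A) : horner_alg a u * horner_alg b v =
    \sum_(e < m) \sum_(k < m) (u`_e * v`_k) *: (a ^+ e * b ^+ k).
  rewrite (horner_alg_sum _ um) (horner_alg_sum _ vm) mulr_suml; apply: eq_bigr => e _; rewrite mulr_sumr.
  by apply: eq_bigr => k _; rewrite -scalerAl -scalerAr scalerA.
have c : GRing.comm (ha i v) (ha i.+1 u).
  by apply: comm_horner_alg; apply/commr_sym; apply: comm_horner_alg; exact: commr_sym.
rewrite c !prodE mulr_sumr mulr_suml -sumrB; apply: lspan_sum => e.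
rewrite mulr_sumr mulr_suml -sumrB; apply: lspan_sum => k.
rewrite -scalerAr -scalerAl -scalerBr; apply: lspanZ.
have -> : y ^+ e * x ^+ k = x ^+ k * y ^+ e.
  by apply: commrX; apply/commr_sym; exact: commrX.
by apply: span2_le (T_monom e k); have := ltn_ord e; have := ltn_ord k; lia.
Qed.

End TwoVariables.
Definition evspan D := lspan (fun a : A => exists2 g, bounded D g & a = ev g).

(** Only the variables i - 1 and i interact with T_i. Corrections can reach the larger of their two
    degrees in either variable, hence one common bound for both. *)
Lemma T_ev i D g : (0 < i < n)%N -> (forall j, D (sgen n i j) = D j) -> bounded D g ->
  evspan D (T i * ev g - ev (fun j => g (sgen n i j)) * T i).
Proof.
case: i => // i iN Ds bg; have i1 : (i < n)%N by lia.
have i2 : (i.+1 < n)%N by lia.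
pose a := Ordinal i1; pose b := Ordinal i2.
have ab : a != b by rewrite -(inj_eq val_inj) /=; lia.
have sE : sgen n i.+1 = tperm a b.
  by congr tperm; apply: val_inj; rewrite /= inordK.
have Dab : D a = D b by rewrite -[D b]Ds sE tpermR.
have gE : ev g = ev (upd2 g a b 1 1) * (ha a (g a) * ha b (g b)).
  rewrite -ev_upd2 //; apply: eq_ev => j; rewrite /upd2 /upd.
  by case: eqP => [->//|_]; case: eqP => [->|].
have gsE : ev (fun j => g (sgen n i.+1 j)) = ev (upd2 g a b 1 1) * (ha a (g b) * ha b (g a)).
  rewrite -ev_upd2 //; apply: eq_ev => j; rewrite /upd2 /upd sE.
  by case: tpermP => [->|->|/eqP/negPf -> /eqP/negPf ->]; rewrite ?eqxx // eq_sym (negPf ab).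
have cE : GRing.comm (T i.+1) (ev (upd2 g a b 1 1)).
  apply: comm_ev => j; rewrite /upd2 /upd.
  case: eqP => [_|/eqP ja]; first by right.
  case: eqP => [_|/eqP jb]; first by right.
  left; rewrite -(inj_eq val_inj) /= in ja; rewrite -(inj_eq val_inj) /= in jb.
  have [ij|ji] := ltnP i.+1 j; first by apply: comm_T_JM_lt => //; exact: ltn_ord.
  by apply: comm_T_JM_gt => //; lia.
rewrite gE gsE mulrA cE -!mulrA -mulrBr [_ * (_ * T _)]mulrA.
have bb : (size (g b) <= D a)%N by rewrite Dab.
apply: lspan_mull (T_ha_ha i2 (bg a) bb) => _ [u [v [ua va ->]]].
apply: lspan_gen; exists (upd2 g a b u v); last by rewrite -ev_upd2.
move=> j; rewrite /upd2 /upd; case: eqP => [->//|_]; case: eqP => [->|//].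
by rewrite -Dab.
Qed.

Definition evTw_span D (P : 'S_n -> Prop) :=
  lspan (fun a : A => exists g z, [/\ bounded D g, P z & a = ev g * Tw z]).

Lemma evTw_spanM D P a z : evspan D a -> P z -> evTw_span D P (a * Tw z).
Proof.
move=> sa Pz; apply: lspan_mulr sa => _ [g bg ->]; apply: lspan_gen.
by exists g, z.
Qed.

Lemma T_ev_Tw i D g z (P : 'S_n -> Prop) : (0 < i < n)%N ->
  (forall j, D (sgen n i j) = D j) -> bounded D g -> P z -> P (sgen n i * z)%g ->
  evTw_span D P (T i * (ev g * Tw z)).
Proof.
move=> iN Ds bg Pz Psz; rewrite mulrA -[T i * ev g](subrK (ev (fun j => g (sgen n i j)) * T i)).
rewrite mulrDl; apply: lspanD; first by apply: evTw_spanM => //; exact: T_ev.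
rewrite -mulrA; apply: lspan_mull (T_Tw_span z iN) => _ [y yz ->]; apply: lspan_gen.
exists (fun j => g (sgen n i j)), y; split=> //; last by case: yz => ->.
by move=> j; rewrite -Ds.
Qed.

(** Each correction from [T_ev] loses the letter T_i, and left multiplication by T_i lengthens
    earlier corrections by at most one, so all of them stay shorter than [z]. *)
Lemma Tw_ev m D g z : fixes_from m z ->
  (forall j k : 'I_n, (j < m)%N -> (k < m)%N -> D j = D k) -> bounded D g ->
  evTw_span D (fun y => fixes_from m y /\ (inv y < inv z)%N)
    (Tw z * ev g - ev (fun j => g (z j)) * Tw z).
Proof.
move=> fz Dm bg; elim/perm_descent_ind: z fz => [|i z iN bi IH] fz.
  rewrite Tw_1 mul1r mulr1 (@eq_ev _ g) ?subrr; first exact: lspan0.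
  by move=> j; rewrite perm1.
have [/andP[_ im] sz'] := descent_in_support iN bi (fixes_from_supported fz).
have {sz'}fz' : fixes_from m z by move=> j mj; apply: sz'; lia.
have fs := fixes_from_sgen iN im.
have Ds j : D (sgen n i j) = D j.
  have [jm|mj] := ltnP j m; last by rewrite fs.
  by apply: Dm => //; rewrite fixes_from_lt.
have bgz : bounded D (fun j => g (z j)).
  move=> j; have [jm|mj] := ltnP j m; last by rewrite fz'.
  by rewrite (Dm j (z j)) // fixes_from_lt.
rewrite Tw_sgen //.
have -> : T i * Tw z * ev g - ev (fun j => g ((sgen n i * z)%g j)) * (T i * Tw z) =
  T i * (Tw z * ev g - ev (fun j => g (z j)) * Tw z) +
  (T i * ev (fun j => g (z j)) - ev (fun j => g (z (sgen n i j))) * T i) * Tw z.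
  rewrite mulrBr mulrBl !mulrA addrA subrK; congr (_ - _ * _ * _).
  by apply: eq_ev => j; rewrite permM.
apply: lspanD; last first.
  by apply: evTw_spanM; [exact: T_ev|rewrite inv_sgen].
apply: lspan_mull (IH fz') => _ [h [y [bh [fy iy] ->]]].
apply: T_ev_Tw => //; rewrite (inv_sgen iN bi); first by split=> //; exact: ltnW.
by split; [exact: fixes_fromM|rewrite ltnS (leq_trans (inv_sgen_le _ iN))].
Qed.

(** * The trace on normal forms, and the products L^(s)_(1,m) *)

Variables (r : nat) (Tr : A -> R).
Hypothesis r_gt0 : (0 < r)%N.
Hypothesis HTr : Tr_spec q T r Tw Tr.

Lemma Tr_lin c a b : Tr (c *: a + b) = c * Tr a + Tr b.
Proof. by case: HTr. Qed.

Lemma Tr0 : Tr 0 = 0.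
Proof.
have := Tr_lin (-1) 0 0; rewrite scaler0 addr0 mulN1r => E.
by rewrite E addNr.
Qed.

Lemma TrD a b : Tr (a + b) = Tr a + Tr b.
Proof. by rewrite -[a]scale1r Tr_lin mul1r scale1r. Qed.

Lemma TrZ c a : Tr (c *: a) = c * Tr a.
Proof. by rewrite -[c *: a]addr0 Tr_lin Tr0 addr0. Qed.

Lemma Tr_sum (I : Type) (s : seq I) (F : I -> A) :
  Tr (\sum_(i <- s) F i) = \sum_(i <- s) Tr (F i).
Proof. exact: (big_morph Tr TrD Tr0). Qed.

(** With degrees < r, expanding into monomials gives basis elements only, and just the trivial one
    contributes. Every evaluation of [Tr] goes through this formula. *)
Lemma Tr_ev_Tw g z : bounded (fun=> r) g ->
  Tr (ev g * Tw z) = (\prod_j (g j)`_0) * (z == 1%g)%:R.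
Proof.
move=> bg.
have -> : ev g = \prod_(j < n) \sum_(e < r) (g j)`_e *: X j ^+ e.
  by apply: eq_bigr => j _; exact: horner_alg_sum.
rewrite bigA_distr_bigA /= mulr_suml Tr_sum.
pose e0 : {ffun 'I_n -> 'I_r} := [ffun=> Ordinal r_gt0].
rewrite (bigD1 e0) //= [X in _ + X]big1 ?addr0 => [|e ne]; rewrite scaler_prod -scalerAl TrZ.
  have := HTr.2 (e0, z); rewrite /AK_basis_el /= => ->.
  rewrite /is_trivial_index /=; have -> : [forall j, val (e0 j) == 0%N].
    by apply/forallP => j; rewrite ffunE.
  by congr (_ * _); apply: eq_bigr => j _; rewrite ffunE.
have := HTr.2 (e, z); rewrite /AK_basis_el /= => ->.
rewrite /is_trivial_index /=; case: forallP => [e00|]; last by rewrite mulr0.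
case/eqP: ne; apply/ffunP => j; rewrite ffunE; apply: val_inj; exact/eqP/e00.
Qed.
Definition linprod (l : seq R) : {poly R} := \prod_(a <- l) ('X - a%:P).

Lemma size_linprod l : size (linprod l) = (size l).+1.
Proof. exact: size_prod_XsubC. Qed.

Lemma size_mul_bound (u v : {poly R}) a b : (size u <= a)%N -> (size v <= b)%N ->
  (size (u * v)%R <= (a + b).-1)%N.
Proof. by move=> ua vb; apply: leq_trans (size_polyMleq _ _) _; lia. Qed.

Lemma linprod_cat l l' : linprod (l ++ l') = linprod l * linprod l'.
Proof. by rewrite /linprod big_cat. Qed.

Definition sym_fam l m : 'I_n -> {poly R} := fun j => if (j < m)%N then linprod l else 1.
(* The products [L^(i,j)_(1,m)] are of this form, see [Lij_sym_ev]. *)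
Definition sym_ev l m : A := ev (sym_fam l m).

Lemma sym_ev_nil m : sym_ev [::] m = 1.
Proof. by rewrite -ev1; apply: eq_ev => j; rewrite /sym_fam /linprod big_nil if_same. Qed.

Lemma sym_ev_cat l l' m : sym_ev (l ++ l') m = sym_ev l m * sym_ev l' m.
Proof.
rewrite -evM; apply: eq_ev => j; rewrite /sym_fam.
by case: ifP; rewrite ?linprod_cat ?mulr1.
Qed.

(** One parameter a at a time: for i > 0 the two variables touched by T_i are both present because i
    < m, and they contribute (x - a)(y - a) = xy - a(x + y) + a^2, which is symmetric. *)
Lemma comm_T_sym_ev i l m : (i < n)%N -> (i < m)%N -> GRing.comm (T i) (sym_ev l m).
Proof.
elim: l => [|a l IH] iN im; first by rewrite sym_ev_nil; exact: commr1.
rewrite -cat1s sym_ev_cat; apply: commrM; last exact: IH.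
case: i iN im {IH} => [|i] iN im.
  by apply: comm_ev => j; left; apply: comm_T0_JM.
have i1 : (i < n)%N by lia.
pose x := Ordinal i1; pose y := Ordinal iN.
have xy : x != y by rewrite -(inj_eq val_inj) /=; lia.
have im' := ltnW im.
have -> : sym_ev [:: a] m = ev (upd2 (sym_fam [:: a] m) x y ('X - a%:P) ('X - a%:P)).
  apply: eq_ev => j; rewrite /upd2 /upd /sym_fam /linprod big_seq1.
  by case: eqP => [->|_]; [|case: eqP => [->|//]]; rewrite /= ?im ?im'.
rewrite ev_upd2 //; apply: commrM.
  apply: comm_ev => j; rewrite /upd2 /upd.
  case: eqP => [_|/eqP jx]; first by right.
  case: eqP => [_|/eqP jy]; first by right.
  left; rewrite -(inj_eq val_inj) /= in jx; rewrite -(inj_eq val_inj) /= in jy.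
  have [ij|ji] := ltnP i.+1 j; first by apply: comm_T_JM_lt => //; exact: ltn_ord.
  by apply: comm_T_JM_gt => //; lia.
rewrite !rmorphB /= !horner_algX !horner_algC.
have -> : (X i - a%:A) * (X i.+1 - a%:A) = X i * X i.+1 - a *: (X i + X i.+1) + (a * a)%:A.
  rewrite mulrBl !mulrBr mulr_algl mulr_algr mulr_algl scalerDr -(scalerA a a) opprB opprD.
  by rewrite !addrA [RHS]addrAC.
have cZ (u : A) : GRing.comm (T i.+1) u -> GRing.comm (T i.+1) (a *: u).
  by move=> cu; rewrite /GRing.comm -(scalerAl a) -(scalerAr a) cu.
apply: commrD; last by rewrite /GRing.comm mulr_algl mulr_algr.
apply: commrB; first exact: comm_T_xy.
by apply: cZ; exact: comm_T_xDy.
Qed.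

Lemma comm_Tw_sym_ev m m' l z : (m' <= m)%N -> fixes_from m' z -> GRing.comm (sym_ev l m) (Tw z).
Proof.
move=> mm fz; apply: (comm_Tw fz) => i /andP[_ iN] im; apply/commr_sym.
by apply: comm_T_sym_ev => //; exact: leq_trans mm.
Qed.

Lemma ha0_params (l : seq R) : perm_eq l Qs -> ha 0%N (linprod l) = 0.
Proof.
move=> lQ; rewrite /linprod (perm_big _ lQ) rmorph_prod /=; case: HAK => <- _ _ _ _.
by apply: eq_bigr => a _; rewrite rmorphB /= horner_algX horner_algC.
Qed.

(* Since [Z] commutes with [T_0, ..., T_(c-1)], the algebra they
   generate acts on [Z *] reduced elements; degrees in [L_1] are cut by
   [Z_0], and those in [L_2, ..., L_c] because [L_(j+1)] is [q^-1 T_j L_j T_j]. *)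
Section Reduction.

Variables (Z : A) (c : nat) (l : seq R) (D : 'I_n -> nat) (P : 'S_n -> Prop).
Hypothesis l_gt0 : (0 < size l)%N.
Hypothesis c_le : (c <= n)%N.
Hypothesis D_l : forall j, (j < c)%N -> D j = size l.
Hypothesis Z_comm : forall i, (i < c)%N -> GRing.comm Z (T i).
Hypothesis Z_0 : (0 < c)%N -> Z * ha 0%N (linprod l) = 0.
Hypothesis P_sgen : forall i z, (0 < i < c)%N -> P z -> P (sgen n i * z)%g.

Let reducible a := exists2 y : A, evTw_span D P y & Z * a = Z * y.

Let reducible_lin e a b : reducible a -> reducible b -> reducible (e *: a + b).
Proof.
move=> [a' sa Ea] [b' sb Eb]; exists (e *: a' + b').
  by apply: lspanD => //; exact: lspanZ.
by rewrite !mulrDr -!scalerAr Ea Eb.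
Qed.

Let reducible_T i a : (i < c)%N -> reducible a -> reducible (T i * a).
Proof.
move=> ic [y sy Ey].
suff [y' sy' Ey'] : reducible (T i * y).
  by exists y' => //; rewrite -Ey' !mulrA Z_comm // -!mulrA Ey.
apply: (@lspan_lift _ _ (fun b => exists g z, [/\ bounded D g, P z & b = T i * (ev g * Tw z)])); last first.
  apply: lspan_mull sy => _ [g [z [bg Pz ->]]]; apply: lspan_gen.
  by exists g, z.
move=> _ [g [z [bg Pz ->]]].
have iN : (i < n)%N by exact: leq_trans c_le.
case: i ic iN {Ey} => [|i] ic iN; last first.
  exists (T i.+1 * (ev g * Tw z)) => //; apply: T_ev_Tw => //; last exact: P_sgen.
  move=> j; have [jc|cj] := ltnP j c.
    have sjc : (sgen n i.+1 j < c)%N.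
      by rewrite (fixes_from_lt j (fixes_from_sgen (i := i.+1) iN ic)).
    by rewrite !D_l.
  by rewrite sgen_fix //; lia.
(* Multiplying by T_0 = L_1 can raise the degree to [size l]; [v] is the remainder modulo the monic
   [linprod l], whose multiple is killed by [Z]. *)
pose u := 'X * g ord0; pose v := u - u`_(size l) *: linprod l.
have su : (size u <= (size l).+1)%N.
  apply: leq_trans (size_polyMleq _ _) _; rewrite size_polyX /=.
  by rewrite ltnS -(D_l (j := ord0)).
have sv : (size v <= size l)%N.
  apply/leq_sizeP => e le; rewrite /v coefB coefZ.
  have [->|ne] := eqVneq e (size l).
    have := monic_prod_XsubC l xpredT id; rewrite monicE lead_coefE.
    by rewrite size_linprod /= => /eqP ->; rewrite mulr1 subrr.
  have le' : ((size l).+1 <= e)%N by lia.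
  have -> : (linprod l)`_e = 0 by apply: nth_default; rewrite size_linprod.
  by rewrite (nth_default _ (leq_trans su le')) mulr0 subr0.
exists (ev (upd g ord0 v) * Tw z).
  apply: lspan_gen; exists (upd g ord0 v), z; split=> // j; rewrite /upd.
  by case: eqP => [->|//]; rewrite D_l.
have -> : T 0%N * (ev g * Tw z) = ev (upd g ord0 u) * Tw z.
  have -> : ev g = ev (upd g ord0 (g ord0)).
    by apply: eq_ev => j; rewrite /upd; case: eqP => [->|].
  rewrite mulrA !(ev_upd g ord0 (g ord0)) (ev_upd g ord0 u) rmorphM /= horner_algX.
  have cT : GRing.comm (T 0%N) (ev (upd g ord0 1)).
    by apply: comm_ev => j; left; apply: comm_T0_JM.
  by rewrite !mulrA cT.
have -> : u = u`_(size l) *: linprod l + v by rewrite /v addrC subrK.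
rewrite ev_upd_lin mulrDl mulrDr -scalerAl -scalerAr mulrA.
rewrite (ev_upd g ord0 (linprod l)) (comm_horner_alg (linprod l) (c := X 0%N)); last first.
  by apply/commr_sym; apply: comm_ev => j; left; apply: comm_JM.
by rewrite -(mulrA (ha 0%N (linprod l))) (mulrA Z (ha 0%N (linprod l))) Z_0 // !mul0r scaler0 add0r.
Qed.

Let reducible_JM (j : nat) a : (j < c)%N -> reducible a -> reducible (X j * a).
Proof.
move: j a; elim=> [|j IH] a jc ra; first exact: reducible_T.
rewrite JMS -(scalerAl q^-1) -[_ *: _]addr0; apply: reducible_lin; last first.
  by exists 0 => //; exact: lspan0.
rewrite -!mulrA; apply: reducible_T => //; apply: IH; first exact: ltnW.
exact: reducible_T.
Qed.

Let reducible_ha (j : nat) (u : {poly R}) a : (j < c)%N -> reducible a -> reducible (ha j u * a).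
Proof.
move=> jc; elim/poly_ind: u a => [|u e IH] a ra.
  by rewrite rmorph0 mul0r; exists 0 => //; exact: lspan0.
rewrite rmorphD rmorphM /= horner_algX horner_algC mulrDl mulr_algl addrC.
apply: reducible_lin => //; rewrite -mulrA; apply: IH; exact: reducible_JM.
Qed.

Lemma reduce_ev_Tw g z : (forall j, (c <= j)%N -> (size (g j) <= D j)%N) -> P z ->
  exists2 y : A, evTw_span D P y & Z * (ev g * Tw z) = Z * y.
Proof.
(* Induction on the number k of initial variables of arbitrary degree: the last of them is pulled
   out on the left, where it acts on reducible elements, and is replaced by 1. *)
move=> bg Pz; suff: forall k (g : 'I_n -> {poly R}), (k <= c)%N ->
    (forall j, (k <= j)%N -> (size (g j) <= D j)%N) -> reducible (ev g * Tw z).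
  by move=> H; apply: (H c).
elim=> [|k IH] {bg}g kc bg.
  by exists (ev g * Tw z) => //; apply: lspan_gen; exists g, z; split=> // j; exact: bg.
have kn : (k < n)%N by exact: leq_trans c_le.
pose o := Ordinal kn.
have -> : ev g = ha k (g o) * ev (upd g o 1).
  have -> : ev g = ev (upd g o (g o)).
    by apply: eq_ev => j; rewrite /upd; case: eqP => [->|].
  rewrite ev_upd; apply: comm_horner_alg; apply/commr_sym; apply: comm_ev => j; left.
  exact: comm_JM.
rewrite -mulrA; apply: reducible_ha => //; apply: IH; first exact: ltnW.
move=> j kj; rewrite /upd; case: eqP => [->|/eqP jo].
  by rewrite size_poly1 D_l.
by apply: bg; move: jo; rewrite -(inj_eq val_inj) /=; lia.
Qed.

End Reduction.
Lemma Tr_Tw z : Tr (Tw z) = (z == 1%g)%:R.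
Proof.
rewrite -[Tw z]mul1r -ev1 Tr_ev_Tw; last by move=> j; rewrite size_poly1.
by rewrite big1 ?mul1r // => j _; rewrite coef1.
Qed.

Lemma Tr_ev_mul g a : bounded (fun=> r) g -> lspan (fun t => exists z, t = Tw z) a ->
  Tr (ev g * a) = (\prod_j (g j)`_0) * Tr a.
Proof.
move=> bg; elim=> [|e x y [z ->] _ IH]; first by rewrite mulr0 Tr0 mulr0.
by rewrite mulrDr -scalerAr !Tr_lin Tr_ev_Tw // Tr_Tw IH mulrDr mulrCA.
Qed.

Lemma Tw_Tw_in_span a z : lspan (fun t => exists y, t = Tw y) (Tw a * Tw z).
Proof.
apply: lspan_mono (Tw_Tw_span z (@fixes_from_n _ a)) => _ [y [_ _ ->]].
by apply: lspan_gen; exists (y * z)%g.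
Qed.

(* One block swap. The leading term of [T_w ev G] is [ev (G o w) T_w] and gives
   [step_const]; every lower term [T_t] has [inv t < inv w], whereas the trace
   could only see it, even after the reduction of the first [c] variables, if
   [t] maps the first [c] points beyond the next [m], that is [inv w <= inv t]. *)
Section Step.

(** In the induction m = b_1 + ... + b_k and c = b_(k+1); [l1], [l2], [l3] hold the parameters eps^s
    Q_i with s <= k, s = k+1 and s > k+1. *)
Variables (m c : nat) (l1 l2 l3 : seq R).
Hypothesis mc_le : (m + c <= n)%N.
Hypothesis l_Qs : perm_eq (l3 ++ l1 ++ l2) Qs.
Hypothesis l2_gt0 : (0 < size l2)%N.
Hypothesis l_le_r : (size l1 + size l2 <= r)%N.

Notation w := (wprod n (wab c m)).
Notation w' := (wprod n (wab m c)).

Let cm_le : (c + m <= n)%N. Proof. by rewrite addnC. Qed.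

Definition block_bound (k s : nat) : 'I_n -> nat := fun j => if (j < k)%N then s else 1%N.

(** Constant coefficients of L^(1,k)_(1,c) and L^(k+1)_(1,m), times the trace left over when all
    permutations of the blocks are trivial; [w'] is the inverse of [w]. *)
Definition step_const : R :=
  (\prod_j (sym_fam l1 c j)`_0) * (\prod_j (sym_fam l2 m j)`_0) * Tr (Tw w * Tw w').

Section Swap.

Variables (z x : 'S_n).
Hypothesis z_fix : fixes_from m z.
Hypothesis x_supp : supported_in m (m + c) x.

Let u := (z * x * w')%g.

Let u_l (a : 'I_n) : (u a < c)%N = (m <= a < m + c)%N.
Proof.
have zx := fixes_from_lt a z_fix; have xx := supported_lt (z a) x_supp.
have xs := @x_supp (z a).
rewrite /u !permM wabE //.
have [am|ma] := ltnP a m.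
  rewrite am in zx; rewrite xs; last by lia.
  by repeat (case: ifP => ?); lia.
rewrite (z_fix ma) in xx xs *; have [ac|ca] := ltnP a (m + c).
  have {}xx : (m <= x a < m + c)%N by rewrite xx ma ac.
  by repeat (case: ifP => ?); lia.
rewrite xs; last by lia.
by repeat (case: ifP => ?); lia.
Qed.

Let u_r (a : 'I_n) : (c <= u a < c + m)%N = (a < m)%N.
Proof.
have zx := fixes_from_lt a z_fix; have xx := supported_lt (z a) x_supp.
have xs := @x_supp (z a).
rewrite /u !permM wabE //.
have [am|ma] := ltnP a m.
  rewrite am in zx; rewrite xs; last by lia.
  by repeat (case: ifP => ?); lia.
rewrite (z_fix ma) in xx xs *; have [ac|ca] := ltnP a (m + c).
  have {}xx : (m <= x a < m + c)%N by rewrite xx ma ac.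
  by repeat (case: ifP => ?); lia.
rewrite xs; last by lia.
by repeat (case: ifP => ?); lia.
Qed.

(** Lengths add twice: [w'] increases on [m, m+c), and [x * w'] increases on [0, m), which [x]
    fixes. *)
Lemma Tw_block_mul : Tw z * (Tw x * Tw w') = Tw u.
Proof.
rewrite (Tw_mul x_supp (increasing_wab_r mc_le)).
rewrite (Tw_mul (fixes_from_supported z_fix)) ?mulgA //.
apply: increasing_mul_fix (increasing_wab_l mc_le) => j jm; apply: x_supp; lia.
Qed.

Lemma fixes_from_block_mul : fixes_from (m + c) u.
Proof.
apply: fixes_fromM (fixes_from_wab mc_le); apply: fixes_fromM.
  by apply: fixes_from_le z_fix; rewrite leq_addr.
by move=> j mj; apply: x_supp; lia.
Qed.

Lemma swap_not_fixes t : (inv t < inv w)%N -> ~ fixes_from c (t * u)%g.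
Proof.
move=> it /fixes_fromV ftu.
have := inv_wab_le (z := t) cm_le ftu u_l u_r.
rewrite -mulgA mulVg => /(_ erefl); lia.
Qed.

(** In the expansion of T_w T_u into T_(t u), a nonzero trace needs t u = 1. Shorter t are excluded
    by [swap_not_fixes], and t = w gives z x = 1, where [z] and [x] have disjoint supports. *)
Lemma Tr_swap : Tr (Tw w * Tw u) = ((z == 1%g) && (x == 1%g))%:R * Tr (Tw w * Tw w').
Proof.
have [/andP[/eqP z1 /eqP x1]|zx1] := boolP (_ && _).
  by rewrite /u z1 x1 !mul1g mul1r.
rewrite mul0r; have zx : (z * x != 1)%g.
  apply: contra zx1 => /eqP zx.
  have z1 : z = 1%g.
    apply/permP => j; rewrite perm1; have [jm|/z_fix //] := ltnP j m.
    have zj := fixes_from_lt j z_fix; rewrite jm in zj.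
    have := congr1 (fun s : 'S_n => s j) zx; rewrite permM perm1 x_supp //; lia.
  by move: zx; rewrite z1 mul1g => ->; rewrite !eqxx.
elim: (Tw_Tw_span u (@fixes_from_n _ w)) => [|e _ b [t [_ tw ->]] _ IH]; first exact: Tr0.
rewrite Tr_lin IH addr0 Tr_Tw; case: eqP => [tu|]; last by rewrite mulr0.
case: tw => [tw|/swap_not_fixes[]]; last by rewrite tu; exact: fixes_from1.
case/eqP: zx; apply: (mulgI w); apply: (mulIg w').
by rewrite mulg1 wab_mulK // -[RHS]tu tw /u !mulgA.
Qed.

End Swap.

Lemma step_generator g z (be : 'I_n -> {poly R}) x :
  bounded (block_bound m (size l1)) g -> fixes_from m z ->
  (forall j, (m <= j < m + c)%N -> (size (be j) <= size l2)%N) ->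
  (forall j, ~~ (m <= j < m + c)%N -> be j = 1) ->
  supported_in m (m + c) x ->
  exists y : A, [/\ evTw_span (block_bound (m + c) (size l1 + size l2)) (fixes_from (m + c)) y,
    sym_ev l3 (m + c) * (sym_ev l1 c * (Tw w * (sym_ev l2 m *
      (ev g * Tw z * (ev be * (Tw x * Tw w')))))) = sym_ev l3 (m + c) * y
    & Tr y = step_const * (\prod_j (be j)`_0 * (x == 1%g)%:R) * Tr (ev g * Tw z)].
Proof.
move=> bg fz bb b1 sx; set u := (z * x * w')%g.
pose G := fun j => sym_fam l2 m j * (g j * be j).
pose D := block_bound (m + c) (size l1 + size l2).
have D_le j : (D j <= r)%N by rewrite /D /block_bound; case: ifP => // _; lia.
(* [ev be] uses only variables of index at least m, so it passes T_z and all polynomials collect in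
   [G]. *)
have mulE : sym_ev l2 m * (ev g * Tw z * (ev be * (Tw x * Tw w'))) = ev G * Tw u.
  have cz : GRing.comm (ev be) (Tw z).
    apply: (comm_Tw fz) => i /andP[i0 iN] im; apply/commr_sym.
    apply: comm_ev => j; have [mj|jm] := leqP m j.
      by left; apply: comm_T_JM_lt; [lia|exact: ltn_ord].
    by right; apply: b1; lia.
  rewrite -(Tw_block_mul fz sx) -[ev g * _ * _]mulrA (mulrA (Tw z)) -cz.
  rewrite -!(mulrA (ev be)) !mulrA /sym_ev -!evM -!mulrA.
  by congr (_ * _); apply: eq_ev => j; rewrite /G mulrA.
have bG : bounded D G.
  move=> j; rewrite /G /D /block_bound /sym_fam; have gj := bg j; rewrite /block_bound in gj.
  have [jm|mj] := ltnP j m.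
    rewrite jm in gj; rewrite ltn_addr // b1 ?mulr1; last by lia.
    apply: leq_trans (size_mul_bound (leqnn _) gj) _.
    by rewrite size_linprod /= addnC.
  rewrite ltnNge mj /= in gj; rewrite mul1r; have [jmc|mcj] := ltnP j (m + c).
    have bj : (size (be j) <= size l2)%N by apply: bb; rewrite mj.
    by apply: leq_trans (size_mul_bound gj bj) _; lia.
  by rewrite b1 ?mulr1 //; lia.
have fw : fixes_from (m + c) w by rewrite addnC; apply: fixes_from_wab.
have D_const (j k : 'I_n) : (j < m + c)%N -> (k < m + c)%N -> D j = D k.
  by rewrite /D /block_bound => -> ->.
have := Tw_ev fw D_const bG; set Y := (X in evTw_span _ _ X) => sY.
have TE : Tw w * ev G = ev (fun j => G (w j)) * Tw w + Y by rewrite addrC subrK.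
pose P y := fixes_from (m + c) y /\ ~ fixes_from c y.
have sYu : evTw_span D P (Y * Tw u).
  apply: lspan_mulr sY => _ [h [y [bh [fy iy] ->]]].
  rewrite -mulrA; apply: lspan_mull (Tw_Tw_span u fy) => _ [t [ft ty ->]].
  apply: lspan_gen; exists h, (t * u)%g; split=> //; split.
    by apply: fixes_fromM => //; exact: fixes_from_block_mul.
  by apply: swap_not_fixes => //; case: ty => [->|]; lia.
pose Z := sym_ev l3 (m + c) * sym_ev l1 c.
pose D' : 'I_n -> nat := fun j => if (j < c)%N then size l2 else D j.
have [Y2 sY2 EY2] : exists2 Y2, evTw_span D' P Y2 & Z * (Y * Tw u) = Z * Y2.
  apply: lspan_lift sYu => _ [h [y [bh Py ->]]].
  apply: (@reduce_ev_Tw Z c l2) => //.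
  - by rewrite (leq_trans _ cm_le) // leq_addr.
  - by move=> j jc; rewrite /D' jc.
  - move=> i ic; have iN : (i < n)%N by lia.
    by apply/commr_sym/commrM; apply: comm_T_sym_ev => //; lia.
  (* In L_1, [Z] already has the factors of [l3] and [l1] (here 0 < c matters); those of [l2]
     complete the order relation of T_0. *)
  - move=> c0; have -> : ha 0%N (linprod l2) = sym_ev l2 1.
      rewrite -(ev_single ord0); apply: eq_ev => j; rewrite /upd /sym_fam.
      by rewrite -(inj_eq val_inj) /= ltnS leqn0.
    have -> : Z * sym_ev l2 1 = ev (upd (fun j => sym_fam l3 (m + c) j * sym_fam l1 c j) ord0
        (linprod (l3 ++ l1 ++ l2))).
      rewrite /Z /sym_ev -!evM; apply: eq_ev => j; rewrite /upd /sym_fam.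
      have [->|j0] := eqVneq j ord0.
        by rewrite /= c0 addn_gt0 c0 orbT !linprod_cat mulrA.
      by rewrite ltnS leqn0 -(inj_eq val_inj) /= in j0 *; rewrite (negPf j0) mulr1.
    by rewrite ev_upd ha0_params // mulr0.
  - move=> i y' ic [fy nfy]; have iN : (0 < i < n)%N by lia.
    have fs : fixes_from c (sgen n i) by apply: fixes_from_sgen => //; lia.
    split; first by apply: fixes_fromM => //; apply: fixes_from_le fs; lia.
    by move=> /(fixes_fromM fs); rewrite mulgA sgen2 mul1g.
  - by move=> j cj; rewrite /D' ltnNge cj.
exists (sym_ev l1 c * (ev (fun j => G (w j)) * (Tw w * Tw u) + Y2)).
(* The leading term needs no reduction: for j < c, [w] sends j to j + m, where [G] has no factor
   from [l2] and [g] is constant, so only [l1] and [be] contribute degree. *)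
have bGw : bounded D (fun j => sym_fam l1 c j * G (w j)).
  move=> j; rewrite /sym_fam; have [jc|cj] := ltnP j c; last first.
    rewrite mul1r; apply: leq_trans (bG _) _.
    by rewrite /D /block_bound fixes_from_lt.
  have wj : w j = (j + m)%N :> nat by rewrite wabE // jc.
  have -> : D j = (size l1 + size l2)%N by rewrite /D /block_bound ltn_addl.
  have gj : (size (g (w j)) <= 1)%N.
    by have := bg (w j); rewrite /block_bound wj ltnNge leq_addl.
  have bj : (size (be (w j)) <= size l2)%N.
    by apply: bb; rewrite wj leq_addl addnC ltn_add2l jc.
  have := size_mul_bound (leqnn (size (linprod l1))) (size_mul_bound gj bj).
  rewrite size_linprod /G /sym_fam wj ltnNge leq_addl /= mul1r => /leq_trans; apply; lia.
have bD' h : bounded D' h -> bounded D (fun j => sym_fam l1 c j * h j).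
  move=> bh j; rewrite /sym_fam; have := bh j; rewrite /D'.
  have [jc|cj hj] := ltnP j c; last by rewrite mul1r.
  move=> /(size_mul_bound (leqnn (size (linprod l1)))) /leq_trans; apply.
  by rewrite size_linprod /D /block_bound ltn_addl //; lia.
split.
- rewrite mulrDr; apply: lspanD.
    rewrite mulrA -evM; apply: lspan_mull (Tw_Tw_span u fw) => _ [t [ft _ ->]].
    apply: lspan_gen; exists (fun j => sym_fam l1 c j * G (w j)), (t * u)%g; split=> //.
    by apply: fixes_fromM => //; exact: fixes_from_block_mul.
  apply: lspan_mull sY2 => _ [h [t [bh [ft _] ->]]]; apply: lspan_gen.
  exists (fun j => sym_fam l1 c j * h j), t; split=> //; first exact: bD'.
  by rewrite evM mulrA.
- rewrite mulE mulrA -/Z (mulrA (Tw w)) TE [in RHS]mulrA -/Z mulrDl 2!mulrDr EY2.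
  by rewrite -mulrA.
(* A permutation outside S_c is not 1, and the degrees are now small enough for [Tr_ev_Tw]. *)
have Tr2 : Tr (sym_ev l1 c * Y2) = 0.
  elim: sY2 => [|e _ b [h [t [bh [_ nft] ->]]] _ IH]; first by rewrite mulr0 Tr0.
  rewrite mulrDr -scalerAr Tr_lin IH addr0 mulrA -evM Tr_ev_Tw; last first.
    by move=> j; apply: leq_trans (bD' _ bh j) (D_le j).
  by case: eqP nft => [->|_ _]; [case; exact: fixes_from1|rewrite !mulr0].
rewrite mulrDr TrD Tr2 addr0 mulrA -evM Tr_ev_mul; first last.
- exact: Tw_Tw_in_span.
- by move=> j; apply: leq_trans (bGw j) (D_le j).
rewrite Tr_swap // Tr_ev_Tw; last first.
  move=> j; apply: leq_trans (bg j) _; rewrite /block_bound; case: ifP => _; lia.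
have -> : \prod_j (sym_fam l1 c j * G (w j))`_0 = (\prod_j (sym_fam l1 c j)`_0) *
   ((\prod_j (sym_fam l2 m j)`_0) * ((\prod_j (g j)`_0) * \prod_j (be j)`_0)).
  under eq_bigr => j _ do rewrite coef0M.
  have GE : \prod_j (G (w j))`_0 = \prod_j (G j)`_0.
    by rewrite [RHS](reindex_inj (@perm_inj _ w)).
  rewrite big_split /= GE; congr (_ * _).
  by under eq_bigr => j _ do rewrite /G !coef0M; rewrite !big_split.
by rewrite /step_const -mulnb natrM; ring.
Qed.

Lemma step (y : A) (be : 'I_n -> {poly R}) x :
  evTw_span (block_bound m (size l1)) (fixes_from m) y ->
  (forall j, (m <= j < m + c)%N -> (size (be j) <= size l2)%N) ->
  (forall j, ~~ (m <= j < m + c)%N -> be j = 1) ->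
  supported_in m (m + c) x ->
  exists y' : A, [/\ evTw_span (block_bound (m + c) (size l1 + size l2)) (fixes_from (m + c)) y',
    sym_ev l3 (m + c) * (sym_ev l1 c * (Tw w * (sym_ev l2 m *
      (y * (ev be * (Tw x * Tw w')))))) = sym_ev l3 (m + c) * y'
    & Tr y' = step_const * (\prod_j (be j)`_0 * (x == 1%g)%:R) * Tr y].
Proof.
move=> + bb b1 sx; elim=> [|e _ b [g [z [bg fz ->]]] _ [yb [sb Eb Trb]]].
  by exists 0; split; [exact: lspan0|rewrite !(mul0r, mulr0)|rewrite Tr0 mulr0].
have [ya [sa Ea Tra]] := step_generator bg fz bb b1 sx.
exists (e *: ya + yb); split; first by apply: lspanD => //; exact: lspanZ.
  by rewrite mulrDl !mulrDr -!(scalerAl e) -!(scalerAr e) Ea Eb.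
by rewrite !Tr_lin Tra Trb; ring.
Qed.

End Step.

(** * Assembling v_b, w_b and the basis of H_(d,b) *)

Section Composition.

Variables (eps : R) (p d : nat) (Q : 'I_d -> R) (b : seq nat).
Hypothesis d_gt0 : (0 < d)%N.
Hypothesis Qs_def : Qs = AK_params eps p Q.
Hypothesis r_def : r = (p * d)%N.
Hypothesis size_b : size b = p.
Hypothesis sumn_b : sumn b = n.

Notation M := (bsum b 1).
Notation part := (nth 0%N b).

Definition params s : seq R := [seq eps ^+ s * Q e | e <- enum 'I_d].
Definition params_from s k : seq R := flatten [seq params t | t <- iota s k].

Lemma size_params s : size (params s) = d.
Proof. by rewrite size_map size_enum_ord. Qed.

Lemma size_params_from s k : size (params_from s k) = (k * d)%N.
Proof.
rewrite size_flatten /shape -map_comp; elim: k s => [|k IH] s //=.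
by rewrite size_params IH mulSn.
Qed.

Lemma M_p : M p = n.
Proof. by rewrite bsum_sumn ?size_b // -size_b take_size. Qed.

Lemma M_le k : (k <= p)%N -> (M k <= n)%N.
Proof. by move=> kp; rewrite -M_p; exact: bsum_leq. Qed.

Lemma Ls_ha s k : Ls q T eps Q s k.+1 = ha k (linprod (params s)).
Proof.
rewrite /linprod big_map big_enum rmorph_prod; apply: eq_bigr => i _.
by rewrite rmorphB /= horner_algX horner_algC.
Qed.

Lemma Lij_sym_ev (i j m : nat) : (m <= n)%N ->
  Lij q T eps p Q i j 1 m = sym_ev (flatten [seq params s | s <- Iset p i j]) m.
Proof.
move=> mn; pose l := flatten [seq params s | s <- Iset p i j].
have haE k : \prod_(s <- Iset p i j) Ls q T eps Q s k.+1 = ha k (linprod l).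
  rewrite /l; elim: (Iset p i j) => [|s S IH]; first by rewrite big_nil /linprod big_nil rmorph1.
  by rewrite big_cons IH Ls_ha /= linprod_cat rmorphM.
rewrite /Lij big_add1 /= (eq_bigr _ (fun k _ => haE k)).
rewrite /sym_ev /ev -(big_mkord xpredT (fun k => ha k (if (k < m)%N then linprod l else 1))).
rewrite (big_cat_nat (leq0n m) mn) //= [X in _ * X]big1_seq ?mulr1.
  by apply: eq_big_nat => k /andP[_ ->].
by move=> k; rewrite mem_index_iota => /andP[_ /andP[mk _]]; rewrite ltnNge mk rmorph1.
Qed.

(** v_b nested from the inside: each block adds factors at both ends. The innermost ones (k' = 0)
    are trivial, which is why [v_b] starts at t = 2. *)
Fixpoint vprod k : A :=
  if k is k'.+1 then
    sym_ev (params_from 1 k') (part k') * Tw (wprod n (wab (part k') (M k')))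
      * vprod k' * sym_ev (params k'.+1) (M k')
  else 1.

Lemma vprod_v_b : (0 < p)%N -> vprod p = v_b q T eps p Q Tw b.
Proof.
have H k : (k < p)%N -> vprod k.+1 =
  (\prod_(t <- rev (iota 2 k))
      (Lij q T eps p Q 1 t.-1 1 (bpart b t) * Tab Tw (bpart b t) (bsum b 1 t.-1)))
  * \prod_(t <- iota 2 k) Lsr q T eps p Q t 1 (bsum b 1 t.-1).
  elim: k => [|k IH] kp.
    rewrite /= !big_nil /params_from /= sym_ev_nil !mul1r.
    have -> : wprod n (wab (part 0) (M 0)) = 1%g by rewrite /wab /= wprod_nil.
    rewrite Tw_1 !mul1r -ev1; apply: eq_ev => j; by rewrite /sym_fam ltn0.
  rewrite -[k.+1]addn1 iotaD rev_cat !big_cat /= !big_seq1 addn1.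
  move: (IH (ltnW kp)); set P1 := \prod_(t <- rev _) _; set P2 := \prod_(t <- _) _ => IH'.
  rewrite -[RHS]mulrA (mulrA P1) -IH' add2n /Lsr.
  have Mk := M_le kp; rewrite bsumS in Mk.
  have h1 : (bpart b k.+2 <= n)%N by apply: leq_trans Mk; exact: leq_addl.
  have h2 : (M k.+1 <= n)%N by apply: leq_trans Mk; exact: leq_addr.
  rewrite (Lij_sym_ev 1 k.+1 h1) (Lij_sym_ev k.+2 k.+2 h2).
  rewrite /Iset leqnn subnn /= cats0 /Tab /bpart /= subn1 /=.
  by rewrite -!mulrA.
by case: p H => // k H _; rewrite H // /v_b subn1.
Qed.

Lemma comm_vprod_sym_ev k l m : (k <= p)%N -> (M k <= m)%N ->
  GRing.comm (sym_ev l m) (vprod k).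
Proof.
elim: k => [|k IH] kp km /=; first exact: commr1.
have E := bsumS b k; have kn := M_le kp.
apply: commrM; last exact: ev_comm.
apply: commrM; last by apply: IH; lia.
apply: commrM; first exact: ev_comm.
apply: (@comm_Tw_sym_ev _ (part k + M k)); first lia.
by apply: fixes_from_wab; lia.
Qed.

Section BlockData.

Variables (expo : nat -> nat -> nat) (xs : nat -> 'S_n).
Hypothesis expo_lt : forall t o, (expo t o < d)%N.
Hypothesis xs_supp : forall t, (t < p)%N -> supported_in (M t) (M t.+1) (xs t).

Definition block_mon t : 'I_n -> {poly R} :=
  fun j => if (M t <= j < M t.+1)%N then 'X^(expo t (j - M t)) else 1.

Definition block_triv t : R := (\prod_j (block_mon t j)`_0) * (xs t == 1%g)%:R.

(** The product of the step constants; for k = p it turns out to be Tr(v_b T_b). *)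
Fixpoint kappa k : R :=
  if k is k'.+1 then
    step_const (M k') (part k') (params_from 1 k') (params k'.+1) * kappa k'
  else 1.

Lemma fixes_from_xs t k : (t < k)%N -> (k <= p)%N -> fixes_from (M k) (xs t).
Proof.
move=> tk kp j Mj; apply: xs_supp; first exact: leq_trans kp.
by have := bsum_leq b tk; lia.
Qed.

(** Each permutation is the identity where the other moves points, so lengths add in both orders and
    the permutations commute. *)
Lemma comm_Tw_disjoint m m' z x : fixes_from m z -> supported_in m m' x ->
  GRing.comm (Tw z) (Tw x).
Proof.
move=> fz sx; rewrite /GRing.comm.
have sz := fixes_from_supported fz.
rewrite (Tw_mul sz); last first.
  by move=> i j _ ij jm; rewrite !sx //; lia.
rewrite (Tw_mul sx); last first.
  by move=> i j mi ij jm; rewrite !fz //; lia.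
congr Tw; apply/permP => j; rewrite !permM.
have zj := fixes_from_lt j fz; have xj := supported_lt j sx.
have [jm|mj] := ltnP j m.
  by rewrite jm in zj; rewrite !sx //; lia.
have [jm'|mj'] := ltnP j m'; last by rewrite !(fz j) // !sx ?fz //; lia.
by rewrite !fz //; move: xj; rewrite mj jm'; lia.
Qed.

(** F_k stands on both sides because the reductions hold only after multiplication by it; for k = p
    it is the empty product and the identity becomes exact. *)
Lemma partial_trace k : (k <= p)%N ->
  exists y : A, [/\ evTw_span (block_bound (M k) (k * d)) (fixes_from (M k)) y,
    sym_ev (params_from k.+1 (p - k)) (M k) *
      (vprod k * (\prod_(t < k) ev (block_mon t) *
        (\prod_(t < k) Tw (xs t) * Tw (block_reversal N b k)))) =
    sym_ev (params_from k.+1 (p - k)) (M k) * y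
    & Tr y = kappa k * \prod_(t < k) block_triv t].
Proof.
elim: k => [|k IH] kp.
  exists 1; split.
  - apply: lspan_gen; exists (fun=> 1), 1%g; split; last by rewrite ev1 Tw_1 mulr1.
      by move=> j; rewrite /block_bound size_poly1.
    exact: fixes_from1.
  - by rewrite !big_ord0 /= Tw_1 !mulr1.
  by rewrite big_ord0 mulr1 -Tw_1 Tr_Tw eqxx.
have [y [sy Ey Try]] := IH (ltnW kp).
have ME := bsumS b k; have Mn := M_le kp.
set m := M k in ME sy Ey *; set c := part k in ME *.
have mcn : (m + c <= n)%N by rewrite -ME.
have cmn : (c + m <= n)%N by rewrite addnC.
pose l1 := params_from 1 k; pose l2 := params k.+1; pose l3 := params_from k.+2 (p - k.+1).
have l23 : params_from k.+1 (p - k) = l2 ++ l3.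
  by rewrite /params_from; have -> : (p - k = (p - k.+1).+1)%N by lia.
have lQ : perm_eq (l3 ++ l1 ++ l2) Qs.
  rewrite perm_catC -catA -l23 Qs_def /l1 /params_from -flatten_cat -map_cat.
  by rewrite -[k.+1]add1n -iotaD subnKC // ltnW.
have l2_gt0 : (0 < size l2)%N by rewrite size_params.
have l12r : (size l1 + size l2 <= r)%N.
  by rewrite size_params size_params_from r_def -mulSnr leq_mul2r kp orbT.
have sx := xs_supp kp; rewrite ME -/m in sx.
have fb : fixes_from m (block_reversal N b k) by apply: fixes_from_block_reversal; lia.
have sy' : evTw_span (block_bound m (size l1)) (fixes_from m) y.
  by rewrite size_params_from.
have be_size (j : 'I_n) : (m <= j < m + c)%N -> (size (block_mon k j) <= size l2)%N.
  by rewrite /block_mon ME => ->; rewrite size_polyXn size_params expo_lt.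
have be_out (j : 'I_n) : ~~ (m <= j < m + c)%N -> block_mon k j = 1.
  by rewrite /block_mon ME => /negPf ->.
have [y' [sy2 Ey2 Try2]] := step mcn lQ l2_gt0 l12r sy' be_size be_out sx.
exists y'; split.
- by move: sy2; rewrite size_params size_params_from -mulSnr ME.
- set w := wprod n (wab c m) in Ey2; set w' := wprod n (wab m c) in Ey2.
  have fw : fixes_from (m + c) w by rewrite addnC; exact: fixes_from_wab.
  (* [G] is the part of F_(k+1) in the new variables. The rest of F_(k+1) joins L^(k+1)_(1,m) to
     form F_k, so [pull] exposes the induction hypothesis. *)
  pose G := ev (fun j : 'I_n => if (m <= j < m + c)%N then linprod l3 else 1).
  have GE : sym_ev l3 (m + c) = G * sym_ev l3 m.
    rewrite /G /sym_ev -evM; apply: eq_ev => j; rewrite /sym_fam.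
    by case: (ltnP j m) => jm /=; [rewrite ltn_addr // mul1r|rewrite mulr1].
  have pull U : sym_ev l3 (m + c) * (sym_ev l1 c * (Tw w * (sym_ev l2 m * U))) =
      sym_ev l1 c * (Tw w * (G * (sym_ev (l2 ++ l3) m * U))).
    rewrite mulrA [sym_ev l3 _ * _]ev_comm -mulrA; congr (_ * _).
    rewrite mulrA (comm_Tw_sym_ev _ (leqnn _) fw) -mulrA; congr (_ * _).
    by rewrite GE sym_ev_cat [sym_ev l2 m * sym_ev l3 m]ev_comm !mulrA.
  have c1 : GRing.comm (ev (block_mon k)) (\prod_(t < k) Tw (xs t) * Tw (block_reversal N b k)).
    have cT z : fixes_from m z -> GRing.comm (ev (block_mon k)) (Tw z).
      move=> fz; apply: (comm_Tw fz) => i /andP[i0 iN] im; apply/commr_sym.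
      apply: comm_ev => j; have [mj|jm] := leqP m j.
        by left; apply: comm_T_JM_lt; [lia|exact: ltn_ord].
      by right; apply: be_out; lia.
    apply: commrM; last exact: cT.
    apply: commr_prod => t _; apply: cT; apply: fixes_from_xs => //; exact: ltnW.
  have c2 := comm_Tw_disjoint fb sx.
  have TrevE : Tw (block_reversal N b k.+1) = Tw (block_reversal N b k) * Tw w'.
    by rewrite /= (Tw_mul (fixes_from_supported fb)) //; exact: increasing_wab_l.
  rewrite ME -/l3 TrevE !big_ord_recr /= -/m -/c -/w -/l1 -/l2 -Ey2.
  set E := \prod_(t < k) ev _; set PX := \prod_(t < k) Tw _; set br := Tw (block_reversal N b k).
  rewrite -/PX -/br in c1; rewrite -/br in c2.
  rewrite pull.
  (* L^(k+1)_(1,m) moves left through [vprod k] by symmetry; the new monomial moves right past the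
     T's of the earlier blocks, and [Tw (xs k)] past [br]. *)
  have -> : sym_ev l3 (m + c) * (sym_ev l1 c * Tw w * vprod k * sym_ev l2 m *
      (E * ev (block_mon k) * (PX * Tw (xs k) * (br * Tw w')))) =
    sym_ev l3 (m + c) * (sym_ev l1 c * (Tw w * (sym_ev l2 m *
      (vprod k * (E * (PX * br)) * (ev (block_mon k) * (Tw (xs k) * Tw w')))))).
    congr (_ * _); rewrite -!mulrA; do 2!congr (_ * _).
    rewrite mulrA -(comm_vprod_sym_ev l2 (ltnW kp) (leqnn _)) -!mulrA; do 3!congr (_ * _).
    rewrite (mulrA (Tw (xs k)) br) -c2 -!mulrA (mulrA PX br) (mulrA (ev _) (PX * br)) c1.
    by rewrite -!mulrA.
  rewrite -/E -/PX -/br in Ey; rewrite pull -l23; do 3!congr (_ * _).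
  by rewrite (mulrA _ (vprod k * _)) Ey -mulrA.
rewrite Try2 Try [in RHS]big_ord_recr /= -/m -/c -/l1 -/l2 {3}/block_triv.
by ring.
Qed.

Lemma trace_composition : (0 < p)%N ->
  Tr (v_b q T eps p Q Tw b * (\prod_(t < p) ev (block_mon t) * \prod_(t < p) Tw (xs t)) *
      T_b p Tw b) = kappa p * \prod_(t < p) block_triv t.
Proof.
move=> p0; have [y [_ Ey <-]] := partial_trace (leqnn p).
move: Ey; rewrite subnn /params_from /= sym_ev_nil !mul1r => <-.
by rewrite -vprod_v_b // /T_b -(w_bE size_b sumn_b) -!mulrA.
Qed.

End BlockData.

Lemma ev_block_mon (expo : nat -> nat -> nat) t : (t < p)%N ->
  \prod_(j < part t) L q T (M t + j.+1) ^+ expo t j = ev (block_mon expo t).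
Proof.
move=> tp; have E := bsumS b t; have Mn := M_le tp.
pose F k := if (M t <= k < M t.+1)%N then X k ^+ expo t (k - M t)%N else 1.
have -> : ev (block_mon expo t) = \prod_(k < n) F k.
  apply: eq_bigr => k _; rewrite /block_mon /F; case: ifP => _; last by rewrite rmorph1.
  by rewrite rmorphXn /= horner_algX.
rewrite -(big_mkord xpredT F) (big_cat_nat (leq0n (M t.+1)) Mn) /=.
rewrite (big_cat_nat (leq0n (M t))) /=; last by rewrite E leq_addr.
have F1 k l : (forall e, (k <= e < l)%N -> ~~ (M t <= e < M t.+1)%N) ->
    \prod_(k <= e < l) F e = 1.
  move=> kl; rewrite big_nat_cond big1 // => e; rewrite andbT => /kl /negPf ne.
  by rewrite /F ne.
rewrite [X in X * _ * _]F1 ?[X in _ * _ * X]F1 ?mul1r ?mulr1; [|move=> e; lia|move=> e; lia].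
have := big_addn (idx := 1) (op := *%R) 0 (M t.+1) (M t) xpredT F; rewrite add0n => ->.
rewrite E addKn big_mkord; apply: eq_bigr => j _.
rewrite /F leq_addl addnK [X in (X < _)%N]addnC E ltn_add2l ltn_ord.
by rewrite /L addnS addnC.
Qed.

Implicit Types (idx : Hdb_index p d b).

(** Total functions on naturals free the induction over blocks from the dependent type of
    [Hdb_index]; the default 0 respects the bound because d > 0. *)
Definition index_expo idx t o : nat :=
  if (insub t : option 'I_p) is Some t' then
    if (insub o : option 'I_(part t')) is Some o' then (idx t').1 o' else 0%N
  else 0%N.

Definition index_perm idx t : 'S_n :=
  if (insub t : option 'I_p) is Some t' then shiftp n (M t) (idx t').2 else 1%g.

Lemma index_expo_lt idx t o : (index_expo idx t o < d)%N.
Proof.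
rewrite /index_expo; case: insubP => [t' _ _|_] //.
by case: insubP => [o' _ _|_] //; exact: ltn_ord.
Qed.

Lemma index_expoE idx (t : 'I_p) (o : 'I_(part t)) : index_expo idx t o = (idx t).1 o.
Proof. by rewrite /index_expo !valK. Qed.

Lemma index_permE idx (t : 'I_p) : index_perm idx t = shiftp n (M t) (idx t).2.
Proof. by rewrite /index_perm valK. Qed.

Lemma index_perm_supp idx t : (t < p)%N -> supported_in (M t) (M t.+1) (index_perm idx t).
Proof.
move=> tp j; have Mn := M_le tp; rewrite -[t]/(val (Ordinal tp)) index_permE.
by rewrite bsumS in Mn *; exact: shiftp_out.
Qed.

Lemma Theta_elE idx : Theta_el q T Tw idx =
  \prod_(t < p) ev (block_mon (index_expo idx) t) * \prod_(t < p) Tw (index_perm idx t).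
Proof.
congr (_ * _); apply: eq_bigr => t _; last by rewrite index_permE.
rewrite -ev_block_mon //; apply: eq_bigr => o _; by rewrite index_expoE.
Qed.

(** A single nonzero exponent makes one constant coefficient vanish. *)
Lemma index_triv idx (t : 'I_p) : block_triv (index_expo idx) (index_perm idx) t =
  ([forall o, val ((idx t).1 o) == 0%N] && ((idx t).2 == 1%g))%:R.
Proof.
have Mn := M_le (ltn_ord t); rewrite bsumS in Mn.
rewrite /block_triv index_permE shiftp_eq1 // -mulnb natrM; congr (_ * _).
case: forallP => [h|h].
  rewrite big1 // => j _; rewrite /block_mon; case: ifP => [jt|_]; last by rewrite coef1.
  have jo : (j - M t < part t)%N by have := bsumS b t; lia.
  have := index_expoE idx (Ordinal jo); rewrite /= => ->.
  by rewrite (eqP (h _)) coef1.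
have /forallPn[o no] : ~~ [forall o, val ((idx t).1 o) == 0%N] by apply/forallP.
have on : (M t + o < n)%N by have := ltn_ord o; lia.
rewrite (bigD1 (Ordinal on)) //= /block_mon /= leq_addr bsumS ltn_add2l ltn_ord addKn.
by rewrite index_expoE coefXn eq_sym (negPf no) mul0r.
Qed.

Lemma trace_Theta (h : Hdb_index p d b -> R) : (0 < p)%N ->
  Tr (v_b q T eps p Q Tw b * Theta_b q T Tw h * T_b p Tw b) =
  Tr_b h * Tr (v_b q T eps p Q Tw b * T_b p Tw b).
Proof.
move=> p0.
have main idx : Tr (v_b q T eps p Q Tw b * Theta_el q T Tw idx * T_b p Tw b) =
    kappa p * [forall t, [forall o, val ((idx t).1 o) == 0%N] && ((idx t).2 == 1%g)]%:R.
  rewrite Theta_elE trace_composition //; [|exact: index_expo_lt|exact: index_perm_supp].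
  congr (_ * _); case: forallP => [tr|/forallP/forallPn[t nt]].
    by rewrite big1 // => t _; rewrite index_triv tr.
  by rewrite (bigD1 t) //= index_triv (negPf nt) mul0r.
(* The trivial index has [Theta_el] equal to 1, so [main] itself identifies the constant. *)
have vT : Tr (v_b q T eps p Q Tw b * T_b p Tw b) = kappa p.
  pose idx0 : Hdb_index p d b := [ffun t => ([ffun=> Ordinal d_gt0], 1%g)].
  have := main idx0.
  rewrite Theta_elE big1 => [|t _]; last first.
    rewrite -ev1; apply: eq_ev => j; rewrite /block_mon /index_expo; case: ifP => // _.
    by case: insubP => // t' _ _; case: insubP => // o' _ _; rewrite !ffunE.
  rewrite mul1r big1 => [|t _]; last first.
    have Mn := M_le (ltn_ord t); rewrite bsumS in Mn.
    by rewrite index_permE -Tw_1; congr Tw; apply/eqP; rewrite shiftp_eq1 // ffunE.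
  rewrite mulr1 => ->; case: forallP => [_|[t]]; first by rewrite mulr1.
  by rewrite ffunE /= eqxx andbT; apply/forallP => o; rewrite ffunE.
rewrite /Theta_b /Tr_b mulr_sumr mulr_suml Tr_sum mulr_suml; apply: eq_bigr => idx _.
by rewrite -scalerAr -scalerAl TrZ main vT mulrA mulrAC.
Qed.

End Composition.

End HeckeAlgebra.

Unset Implicit Arguments.

Theorem theorem2p21
  (R : comUnitRingType) (p d n : nat) (eps q : R) (Q : 'I_d -> R)
  (Hp : (1 < p)%N) (Hd : (0 < d)%N) (Hn : (3 <= n)%N)
  (Heps : p.-primitive_root eps)
  (Hq : q \is a GRing.unit) (HQ : forall i, Q i \is a GRing.unit)
  (* H_{r,n} = H_{r,n}(eps Q_1, ..., eps^p Q_d), r = p d, given abstractly *)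
  (A : algType R) (T : nat -> A) (Tw : 'S_n -> A) (Tr : A -> R)
  (HAK : AK_relations q T (AK_params eps p Q) n)
  (HTw : Tw_spec T Tw)
  (Hbasis : AK_is_basis q T (p * d) Tw)
  (HTr : Tr_spec q T (p * d) Tw Tr)
  (b : seq nat) (Hb : Comp p n b)
  (h : Hdb_index p d b -> R) :
  Tr (v_b q T eps p Q Tw b * Theta_b q T Tw h * T_b p Tw b)
  = Tr_b h * Tr (v_b q T eps p Q Tw b * T_b p Tw b).
Proof.
case: n Hn Tw Tr HAK HTw Hbasis HTr Hb => // N _ Tw' Tr' HAK' HTw' _ HTr' /andP[/eqP sb /eqP sn].
have p0 : (0 < p)%N by exact: ltnW.
have r0 : (0 < p * d)%N by rewrite muln_gt0 p0.
exact: (trace_Theta Hq HAK' HTw' r0 HTr' Hd erefl erefl sb sn).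
Qed.
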